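(* Let $a\in C[0,1]$ satisfy the following hypothesis: the open sets $\Omega_-:=a^{-1}((-\infty,0))$ and $\Omega_+:=a^{-1}((0,\infty))$ consist of finitely many nontrivial open intervals, $\Omega_-=\bigcup_{j=1}^r I_j^-$ with $I_j^-=(\alpha_j,\beta_j)$, and $\Omega_+=\bigcup_{i=1}^s I_i^+$ with $I_i^+=(\gamma_i,\varrho_i)$; $a$ vanishes at the endpoints of these intervals, and they are adjacent and interlacing, i.e. each interior interval $I_i^{\pm}$ is surrounded on both sides by intervals of the opposite sign. For $\lambda\in\mathbb R$ consider the elliptic problem $$-u''=\lambda u+a(x)u^2\ \text{ in }(0,1),\qquad u(0)=u(1)=0, \tag{E$_\lambda$}$$ and its parabolic counterpart $$\partial_t u-\partial_{xx}u=\lambda u+a(x)u^2\ (t>0,\ x\in(0,1)),\quad u(0,t)=u(1,t)=0\ (t>0),\quad u(x,0)=u_0(x)\ (x\in[0,1]), \tag{P$_\lambda$}$$ whose unique solution is denoted $u(x,t;u_0,\lambda)$. Suppose that $u_0\ge 0$, $u_0\not\equiv 0$, is a (weak) subsolution of (E$_\lambda$) (for the values of $\lambda$ under consideration), and that $u_0=0$ on some interior positive interval $I_i^+$ together with its two adjacent negative intervals $I_j^-$ and $I_{j+1}^-$, i.e. $$u_0=0\quad\text{in } I_j^-\cup I_i^+\cup I_{j+1}^-=(\alpha_j,\beta_j)\cup(\beta_j,\alpha_{j+1})\cup(\alpha_{j+1},\beta_{j+1}).$$ Then there exists $T=T(u_0)>0$ such that, for every $t\in[0,T]$ and every $x\in(\alpha_j,\beta_{j+1})$,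 $$\lim_{\lambda\downarrow-\infty}u(x,t;u_0,\lambda)=0,$$ and this limit is uniform on compact subintervals of $(\alpha_j,\beta_{j+1})$. An analogous statement holds for the boundary positive intervals $I_1^+=(0,\varrho_1)$ and $I_s^+=(\gamma_s,1)$: e.g., if $I_1^+=(0,\varrho_1)$, $I_1^-=(\varrho_1,\beta_1)$ and $u_0=0$ on $[0,\beta_1]$, then there is $T>0$ such that $\lim_{\lambda\downarrow-\infty}u(x,t;u_0,\lambda)=0$ for all $t\in[0,T]$, $x\in(0,\beta_1)$, uniformly on compact subsets (and symmetrically at the endpoint $1$).
   Context: A subsolution of (E$_\lambda$) is a function $\underline u\in C[0,1]$ with $\underline u(0),\underline u(1)\le 0$ satisfying $-\underline u''\le \lambda\underline u+a\underline u^2$ in the weak (distributional) sense in $(0,1)$. The solution $u(\cdot,\cdot;u_0,\lambda)$ of (P$_\lambda$) exists on a maximal interval $[0,T_{\max}(u_0,\lambda))$. *)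

(* Defs.v *)
From Stdlib Require Import Reals Lra.
From Coquelicot Require Import Coquelicot.
Open Scope R_scope.

Definition cont_on01 (f : R -> R) : Prop :=
  forall x, 0 <= x <= 1 -> forall eps, 0 < eps -> exists delta, 0 < delta /\
    forall y, 0 <= y <= 1 -> Rabs (y - x) < delta -> Rabs (f y - f x) < eps.

(* Structure hypothesis on a: a partition 0 = z 0 < z 1 < ... < z n = 1 such that
   a vanishes at every z k and has a strict constant sign on each (z k, z (k+1)),
   the signs alternating ((-1)^k * e with e = ±1).  The open intervals of the
   partition are exactly the components I_j^- , I_i^+ of Ω_- and Ω_+ (adjacent and
   interlacing). *)
Definition interlacing_weight (a : R -> R) (n : nat) (z : nat -> R) (e : R) : Prop :=
  cont_on01 a /\ (1 <= n)%nat /\ z 0%nat = 0 /\ z n = 1 /\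
  (forall k, (k < n)%nat -> z k < z (S k)) /\
  (forall k, (k <= n)%nat -> a (z k) = 0) /\
  (e = 1 \/ e = -1) /\
  (forall k x, (k < n)%nat -> z k < x < z (S k) -> 0 < e * (-1) ^ k * a x).

Definition nonneg_test_fun (phi : R -> R) : Prop :=
  (forall k x, ex_derive_n phi k x) /\
  (exists delta, 0 < delta /\ forall x, (x <= delta \/ 1 - delta <= x) -> phi x = 0) /\
  (forall x, 0 <= phi x).

Definition weak_subsolution (a : R -> R) (lambda : R) (u : R -> R) : Prop :=
  cont_on01 u /\ u 0 <= 0 /\ u 1 <= 0 /\
  forall phi, nonneg_test_fun phi ->
    RInt (fun x => - u x * Derive_n phi 2 x) 0 1
    <= RInt (fun x => (lambda * u x + a x * (u x) ^ 2) * phi x) 0 1.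

Definition parabolic_solution (a : R -> R) (lambda : R) (u0 : R -> R) (T : R)
    (u : R -> R -> R) : Prop :=
  (forall x t, 0 <= x <= 1 -> 0 <= t <= T -> forall eps, 0 < eps ->
     exists delta, 0 < delta /\ forall y s, 0 <= y <= 1 -> 0 <= s <= T ->
       Rabs (y - x) < delta -> Rabs (s - t) < delta -> Rabs (u y s - u x t) < eps) /\
  (forall x t, 0 < x < 1 -> 0 < t < T ->
     ex_derive (fun s => u x s) t /\
     (forall y, 0 < y < 1 -> ex_derive (fun y' => u y' t) y) /\
     ex_derive (fun y => Derive (fun y' => u y' t) y) x /\
     Derive (fun s => u x s) t - Derive_n (fun y => u y t) 2 x
       = lambda * u x t + a x * (u x t) ^ 2) /\
  (forall t, 0 < t <= T -> u 0 t = 0 /\ u 1 t = 0) /\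
  (forall x, 0 <= x <= 1 -> u x 0 = u0 x).

(* Main.v *)
Require Import Defs.
From Stdlib Require Import Reals Lra Lia ClassicalEpsilon.
From Coquelicot Require Import Coquelicot.
Open Scope R_scope.

(** With [Ma = max |a|], [K = max u0] and [lambda <= - Ma K], the constant [K] is a supersolution,
    so [0 <= u <= K] for every solution, hence [u_t - u_xx <= (lambda + Ma K) u].  With
    [q^2 = - lambda - Ma K], the function [K (exp (- q (x - L)) + exp (- q (Rt - x)))] is then a
    supersolution on [(L, Rt)], where the initial value vanishes, and it tends to [0] locally
    uniformly as [lambda] tends to [- infinity].  One may take [T = 1].

    Existence uses the sine expansion.  The sum of [1 / ((k pi)^2 - lambda)] over [k >= 1] is
    [O(1 / sqrt (- lambda))], so for the truncated nonlinearity the Duhamel map is a contraction in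
    the sup norm as soon as [- lambda] is large, globally in time.  Since [a] is only continuous,
    the series of [u_xx] need not converge; but [a u^2] is Lipschitz in time for [t > 0] (compare
    [u] with its time dilations), which makes the series of [u_t] absolutely convergent, and [u_xx]
    is recovered by integrating [u_t - lambda u - a u^2] twice in [x] and comparing sine
    coefficients. *)

(** * Sine modes, sine coefficients and sine series *)

(** The nonlinearity truncated to [[0, K]] has Lipschitz constant [2 * (Ma * K)] whatever [lambda]
    is, which is why a gain of order [1 / m], with [m ^ 2 = - lambda], can beat it. The maximum
    principle shows afterwards that the solution stays in [[0, K]], where the truncation is
    inactive.

    The free evolution of [u0] cannot be treated by the same summable series: a continuous [u0] has
    merely bounded coefficients, which gives no uniform convergence as [t] tends to [0]. Its flow is
    instead a uniform limit of flows of sine polynomials. This calls for their density among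
    continuous functions vanishing at both ends, and the same density shows that sine coefficients
    determine a function; this links [u] to its expansion and to the double primitive.

    Time dilations about a positive time [d] are preferred to translations: a dilated solution
    agrees with the original at the start, so no initial difference has to be estimated, and after
    time [d] the coefficients already decay like [1 / kap]. *)

Definition clamp (l r x : R) : R := Rmax l (Rmin r x).

Lemma clamp_bounds (l r x : R) : l <= r -> l <= clamp l r x <= r.
Proof.
  intros H; unfold clamp, Rmax, Rmin; repeat destruct Rle_dec; lra.
Qed.

Lemma clamp_id (l r x : R) : l <= x <= r -> clamp l r x = x.
Proof.
  intros H; unfold clamp, Rmax, Rmin; repeat destruct Rle_dec; lra.
Qed.

Lemma clamp_lipschitz (l r x y : R) :
  Rabs (clamp l r x - clamp l r y) <= Rabs (x - y).
Proof.
  unfold clamp, Rmax, Rmin, Rabs; repeat destruct Rle_dec; repeat destruct Rcase_abs; lra.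
Qed.

Lemma Rmax0_lipschitz (x y : R) : Rabs (Rmax 0 x - Rmax 0 y) <= Rabs (x - y).
Proof.
  unfold Rmax, Rabs; repeat destruct Rle_dec; repeat destruct Rcase_abs; lra.
Qed.

Lemma continuous_eps (g : R -> R) (x : R) :
  continuous g x <-> forall eps, 0 < eps -> exists delta, 0 < delta /\
    forall y, Rabs (y - x) < delta -> Rabs (g y - g x) < eps.
Proof.
  unfold continuous; rewrite filterlim_locally; split.
  - intros H eps Heps; destruct (H (mkposreal eps Heps)) as [d Hd].
    exists d; split; [apply cond_pos|]; intros y Hy; exact (Hd y Hy).
  - intros H eps; destruct (H eps (cond_pos eps)) as [d [Hd H']].
    exists (mkposreal d Hd); intros y Hy; exact (H' y Hy).
Qed.

Lemma continuity_pt_of_continuous (g : R -> R) (x : R) : continuous g x -> continuity_pt g x.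
Proof. apply continuity_pt_filterlim. Qed.

Lemma lipschitz_continuous (g : R -> R) (C : R) :
  (forall x y, Rabs (g x - g y) <= C * Rabs (x - y)) -> forall x, continuous g x.
Proof.
  intros H x; apply continuous_eps; intros eps Heps.
  assert (HC : 0 < Rabs C + 1) by (pose proof (Rabs_pos C); lra).
  exists (eps / (Rabs C + 1)); split; [now apply Rdiv_lt_0_compat|].
  intros y Hy; apply Rle_lt_trans with (1 := H y x).
  apply Rle_lt_trans with ((Rabs C + 1) * Rabs (y - x)).
  - apply Rmult_le_compat_r; [apply Rabs_pos|]; pose proof (Rle_abs C); lra.
  - apply Rmult_lt_compat_l with (r := Rabs C + 1) in Hy; [|lra].
    replace ((Rabs C + 1) * (eps / (Rabs C + 1))) with eps in Hy by (field; lra). lra.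
Qed.

Definition sn (k : nat) (x : R) : R := sin (INR (S k) * PI * x).

(** The factor 2 compensates for the squared norm [1 / 2] of each mode on [[0, 1]]. *)
Definition coef (g : R -> R) (k : nat) : R := 2 * RInt (fun x => g x * sn k x) 0 1.

Lemma sn_derive (k : nat) (x : R) :
  is_derive (sn k) x (INR (S k) * PI * cos (INR (S k) * PI * x)).
Proof. unfold sn; generalize (INR (S k)); intros b; auto_derive; auto; ring. Qed.

Lemma sn_continuous (k : nat) (x : R) : continuous (sn k) x.
Proof. apply (ex_derive_continuous (sn k)); eexists; apply sn_derive. Qed.

Lemma sn_bound (k : nat) (x : R) : Rabs (sn k x) <= 1.
Proof. apply Rabs_le, SIN_bound. Qed.

Lemma sin_INR_PI (n : nat) : sin (INR n * PI) = 0.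
Proof.
  induction n as [|n IH]; [simpl; rewrite Rmult_0_l; apply sin_0|].
  rewrite S_INR, Rmult_plus_distr_r, Rmult_1_l, neg_sin, IH; ring.
Qed.

Lemma sn_0 (k : nat) : sn k 0 = 0.
Proof. unfold sn; rewrite Rmult_0_r; apply sin_0. Qed.

Lemma sn_1 (k : nat) : sn k 1 = 0.
Proof. unfold sn; rewrite Rmult_1_r; apply sin_INR_PI. Qed.

Lemma ex_RInt_coef (g : R -> R) (k : nat) :
  (forall x, continuous g x) -> ex_RInt (fun x => g x * sn k x) 0 1.
Proof.
  intros Hg; apply (ex_RInt_continuous (V := R_CompleteNormedModule)); intros x _.
  apply (continuous_mult g (sn k)); [apply Hg | apply sn_continuous].
Qed.

Lemma coef_ext (g h : R -> R) (k : nat) :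
  (forall x, 0 < x < 1 -> g x = h x) -> coef g k = coef h k.
Proof.
  intros H; unfold coef; f_equal; apply RInt_ext.
  rewrite Rmin_left, Rmax_right by lra; intros x Hx; now rewrite H.
Qed.

Lemma coef_linear (g h : R -> R) (c : R) (k : nat) :
  (forall x, continuous g x) -> (forall x, continuous h x) ->
  coef (fun x => g x + c * h x) k = coef g k + c * coef h k.
Proof.
  intros Hg Hh; unfold coef.
  rewrite (RInt_ext _ (fun x => plus (g x * sn k x) (scal c (h x * sn k x)))).
  - rewrite (RInt_plus (V := R_CompleteNormedModule)), (RInt_scal (V := R_CompleteNormedModule)).
    + unfold plus, scal; simpl; unfold mult; simpl; ring.
    + now apply ex_RInt_coef.
    + now apply ex_RInt_coef.
    + apply (ex_RInt_scal (V := R_NormedModule)); now apply ex_RInt_coef.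
  - intros x _; unfold plus, scal; simpl; unfold mult; simpl; ring.
Qed.

Lemma coef_minus (g h : R -> R) (k : nat) :
  (forall x, continuous g x) -> (forall x, continuous h x) ->
  coef (fun x => g x - h x) k = coef g k - coef h k.
Proof.
  intros Hg Hh; rewrite (coef_ext _ (fun x => g x + (-1) * h x)) by (intros; ring).
  rewrite coef_linear by assumption; ring.
Qed.

Lemma coef_bound (g : R -> R) (M : R) (k : nat) :
  (forall x, continuous g x) -> (forall x, 0 <= x <= 1 -> Rabs (g x) <= M) ->
  Rabs (coef g k) <= 2 * M.
Proof.
  intros Hg HM; unfold coef; rewrite Rabs_mult, (Rabs_right 2) by lra.
  apply Rmult_le_compat_l; [lra|].
  rewrite <- (Rmult_1_l M); replace 1 with (1 - 0) at 2 by ring.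
  apply abs_RInt_le_const; [lra | now apply ex_RInt_coef |].
  intros x Hx; rewrite Rabs_mult, <- (Rmult_1_r M).
  apply Rmult_le_compat; auto using Rabs_pos, sn_bound.
Qed.

Lemma coef_dist (g h : R -> R) (d : R) (k : nat) :
  (forall x, continuous g x) -> (forall x, continuous h x) ->
  (forall x, 0 <= x <= 1 -> Rabs (g x - h x) <= d) ->
  Rabs (coef g k - coef h k) <= 2 * d.
Proof.
  intros Hg Hh Hd; rewrite <- coef_minus by assumption.
  apply coef_bound; [|assumption].
  intros x; apply (continuous_minus g h); auto.
Qed.

(** Product-to-sum formulas give explicit primitives that vanish at both ends up to the linear term
    of the diagonal case. That case is separate because the difference frequency would stand in a
    denominator. *)
Lemma coef_sn (j k : nat) : coef (sn j) k = if Nat.eqb j k then 1 else 0.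
Proof.
  unfold coef; pose proof PI_RGT_0 as HPI.
  assert (Hj := sin_INR_PI (S j)); assert (Hk := sin_INR_PI (S k)).
  assert (Hj0 : 0 < INR (S j)) by (apply lt_0_INR; lia).
  assert (Hk0 : 0 < INR (S k)) by (apply lt_0_INR; lia).
  destruct (Nat.eqb_spec j k) as [<-|Hjk].
  - set (a := INR (S j)) in *.
    assert (H : is_RInt (fun x => sn j x * sn j x) 0 1
      (minus ((1 - sin (2 * a * PI * 1) / (2 * a * PI)) / 2)
             ((0 - sin (2 * a * PI * 0) / (2 * a * PI)) / 2))).
    { apply (is_RInt_derive (V := R_CompleteNormedModule)
        (fun x => (x - sin (2 * a * PI * x) / (2 * a * PI)) / 2)).
      - intros x _; auto_derive; [nra|]; unfold sn; fold a.
        replace (2 * a * PI * x) with (2 * (a * PI * x)) by ring.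
        rewrite cos_2a_sin; field; nra.
      - intros x _; apply (continuous_mult (sn j) (sn j)); apply sn_continuous. }
    rewrite (is_RInt_unique (V := R_CompleteNormedModule) _ _ _ _ H).
    replace (2 * a * PI * 1) with (2 * (a * PI)) by ring.
    rewrite sin_2a, Hj, !Rmult_0_r, sin_0.
    unfold minus, plus, opp; simpl; field; nra.
  - assert (Hne : INR (S j) - INR (S k) <> 0).
    { intros H; apply Hjk; assert (E : INR (S j) = INR (S k)) by lra.
      apply INR_eq in E; lia. }
    set (a := INR (S j)) in *; set (b := INR (S k)) in *.
    assert (H : is_RInt (fun x => sn j x * sn k x) 0 1
      (minus ((sin ((a - b) * PI * 1) / ((a - b) * PI) - sin ((a + b) * PI * 1) / ((a + b) * PI)) / 2)
             ((sin ((a - b) * PI * 0) / ((a - b) * PI) - sin ((a + b) * PI * 0) / ((a + b) * PI)) / 2))).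
    { apply (is_RInt_derive (V := R_CompleteNormedModule)
        (fun x => (sin ((a - b) * PI * x) / ((a - b) * PI) - sin ((a + b) * PI * x) / ((a + b) * PI)) / 2)).
      - intros x _; auto_derive; [auto|]; unfold sn; fold a b.
        replace ((a - b) * PI * x) with (a * PI * x - b * PI * x) by ring.
        replace ((a + b) * PI * x) with (a * PI * x + b * PI * x) by ring.
        rewrite cos_minus, cos_plus; field; repeat split; nra.
      - intros x _; apply (continuous_mult (sn j) (sn k)); apply sn_continuous. }
    rewrite (is_RInt_unique (V := R_CompleteNormedModule) _ _ _ _ H).
    replace ((a - b) * PI * 1) with (a * PI - b * PI) by ring.
    replace ((a + b) * PI * 1) with (a * PI + b * PI) by ring.
    rewrite sin_minus, sin_plus, Hj, Hk, !Rmult_0_r, sin_0.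
    unfold minus, plus, opp; simpl; field; repeat split; nra.
Qed.

(* Continuity of [t |-> u(., t)] for the sup distance over the whole line.  Functions given only
   on [0 <= x <= 1], [t >= 0] are extended through [clamp 0 1 x] and [Rmax 0 t]. *)
Definition time_continuous (u : R -> R -> R) : Prop :=
  (forall t x, continuous (fun y => u y t) x) /\
  (forall t eps, 0 < eps -> exists delta, 0 < delta /\
     forall s, Rabs (s - t) < delta -> forall x, Rabs (u x s - u x t) <= eps).

Lemma time_continuous_unif_limit (u : R -> R -> R) :
  (forall eps, 0 < eps -> exists v, time_continuous v /\ forall x t, Rabs (u x t - v x t) <= eps) -> time_continuous u.
Proof.
  intros H; split.
  - intros t x; apply continuous_eps; intros eps Heps.
    destruct (H (eps / 4)) as [v [[Hv _] Huv]]; [lra|].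
    destruct (proj1 (continuous_eps _ _) (Hv t x) (eps / 4)) as [d [Hd Hd']]; [lra|].
    exists d; split; [assumption|]; intros y Hy.
    specialize (Hd' y Hy); generalize (Huv x t) (Huv y t); revert Hd'.
    unfold Rabs; repeat destruct Rcase_abs; lra.
  - intros t eps Heps.
    destruct (H (eps / 4)) as [v [[_ Hv] Huv]]; [lra|].
    destruct (Hv t (eps / 4)) as [d [Hd Hd']]; [lra|].
    exists d; split; [assumption|]; intros s Hs x.
    specialize (Hd' s Hs x); generalize (Huv x t) (Huv x s); revert Hd'.
    unfold Rabs; repeat destruct Rcase_abs; lra.
Qed.

Lemma time_continuous_plus (u v : R -> R -> R) : time_continuous u -> time_continuous v -> time_continuous (fun x t => u x t + v x t).
Proof.
  intros [Hu1 Hu2] [Hv1 Hv2]; split.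
  - intros t x; apply (continuous_plus (fun y => u y t) (fun y => v y t)); auto.
  - intros t eps Heps.
    destruct (Hu2 t (eps / 2)) as [d1 [Hd1 H1]]; [lra|].
    destruct (Hv2 t (eps / 2)) as [d2 [Hd2 H2]]; [lra|].
    exists (Rmin d1 d2); split; [now apply Rmin_glb_lt|]; intros s Hs x.
    specialize (H1 s (Rlt_le_trans _ _ _ Hs (Rmin_l _ _)) x).
    specialize (H2 s (Rlt_le_trans _ _ _ Hs (Rmin_r _ _)) x).
    revert H1 H2; unfold Rabs; repeat destruct Rcase_abs; lra.
Qed.

Lemma time_continuous_mode (c : R -> R) (k : nat) :
  (forall t, continuous c t) -> time_continuous (fun x t => c t * sn k x).
Proof.
  intros Hc; split.
  - intros t x; apply (continuous_mult (fun _ => c t) (sn k)).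
    + apply continuous_const.
    + apply sn_continuous.
  - intros t eps Heps.
    destruct (proj1 (continuous_eps _ _) (Hc t) eps Heps) as [d [Hd H]].
    exists d; split; [assumption|]; intros s Hs x.
    replace (c s * sn k x - c t * sn k x) with ((c s - c t) * sn k x) by ring.
    rewrite Rabs_mult; specialize (H s Hs); pose proof (sn_bound k x).
    pose proof (Rabs_pos (sn k x)); pose proof (Rabs_pos (c s - c t)); nra.
Qed.

Lemma time_continuous_comp (u : R -> R -> R) (p q : R -> R) :
  time_continuous u -> (forall x, continuous p x) -> (forall t, continuous q t) ->
  time_continuous (fun x t => u (p x) (q t)).
Proof.
  intros [Hu1 Hu2] Hp Hq; split.
  - intros t x; apply (continuous_comp p (fun y => u y (q t))); auto.
  - intros t eps Heps.
    destruct (Hu2 (q t) eps Heps) as [d [Hd H]].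
    destruct (proj1 (continuous_eps _ _) (Hq t) d Hd) as [d' [Hd' H']].
    exists d'; split; [assumption|]; intros s Hs x; auto.
Qed.

Lemma coef_time_continuous (u : R -> R -> R) (k : nat) (t : R) :
  time_continuous u -> continuous (fun s => coef (fun x => u x s) k) t.
Proof.
  intros [H1 H2]; apply continuous_eps; intros eps Heps.
  destruct (H2 t (eps / 4)) as [d [Hd H']]; [lra|].
  exists d; split; [assumption|]; intros s Hs.
  apply Rle_lt_trans with (2 * (eps / 4)); [|lra].
  apply coef_dist; auto.
Qed.

(** * Absolutely convergent sine series *)

Lemma Series_tail (a : nat -> R) (N : nat) :
  ex_series a -> Series a = sum_n a N + Series (fun k => a (S N + k)%nat).
Proof.
  intros H; rewrite (Series_incr_n a (S N)); [|lia|assumption].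
  rewrite <- sum_n_Reals; reflexivity.
Qed.

Lemma Series_tail_small (m : nat -> R) (eps : R) :
  ex_series m -> (forall k, 0 <= m k) -> 0 < eps ->
  exists N, forall N', (N <= N')%nat -> Series (fun k => m (S N' + k)%nat) < eps.
Proof.
  intros Hm Hpos Heps; destruct Hm as [l Hl].
  assert (Hl' := proj1 (filterlim_locally _ _) Hl (mkposreal eps Heps)).
  destruct Hl' as [N HN]; exists N; intros N' HN'.
  specialize (HN N' HN'); change (Rabs (sum_n m N' - l) < eps) in HN.
  assert (E := Series_tail m N' (ex_intro _ l Hl)).
  rewrite (is_series_unique _ _ Hl) in E.
  revert HN; unfold Rabs; destruct Rcase_abs; lra.
Qed.

Definition sine_series (c : nat -> R) (x : R) : R := Series (fun k => c k * sn k x).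

Lemma sine_term_bound (c m : nat -> R) (x : R) (k : nat) :
  (forall k, Rabs (c k) <= m k) -> Rabs (c k * sn k x) <= m k.
Proof.
  intros H; rewrite Rabs_mult; specialize (H k); pose proof (sn_bound k x).
  pose proof (Rabs_pos (sn k x)); pose proof (Rabs_pos (c k)); nra.
Qed.

Lemma ex_sine_series (c m : nat -> R) (x : R) :
  (forall k, Rabs (c k) <= m k) -> ex_series m -> ex_series (fun k => c k * sn k x).
Proof.
  intros H Hm; apply (ex_series_le (V := R_CompleteNormedModule) _ m); [|assumption].
  intros k; exact (sine_term_bound c m x k H).
Qed.

Lemma sine_series_bound (c m : nat -> R) (x : R) :
  (forall k, Rabs (c k) <= m k) -> ex_series m ->
  Rabs (sine_series c x) <= Series m.
Proof.
  intros H Hm; unfold sine_series.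
  assert (Habs : ex_series (fun k => Rabs (c k * sn k x))).
  { apply (ex_series_le (V := R_CompleteNormedModule) _ m); [|assumption].
    intros k; change (Rabs (Rabs (c k * sn k x)) <= m k).
    rewrite Rabs_Rabsolu; now apply sine_term_bound. }
  apply Rle_trans with (1 := Series_Rabs _ Habs).
  apply Series_le; [|assumption].
  intros k; split; [apply Rabs_pos | now apply sine_term_bound].
Qed.

Lemma sine_series_minus (c d m m' : nat -> R) (x : R) :
  (forall k, Rabs (c k) <= m k) -> ex_series m ->
  (forall k, Rabs (d k) <= m' k) -> ex_series m' ->
  sine_series c x - sine_series d x = sine_series (fun k => c k - d k) x.
Proof.
  intros Hc Hm Hd Hm'; unfold sine_series; rewrite <- Series_minus.
  - apply Series_ext; intros k; ring.
  - now apply ex_sine_series with m.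
  - now apply ex_sine_series with m'.
Qed.

Lemma sine_series_remainder (c m : nat -> R) (x : R) (N : nat) :
  (forall k, Rabs (c k) <= m k) -> ex_series m ->
  Rabs (sine_series c x - sum_n (fun k => c k * sn k x) N)
    <= Series (fun k => m (S N + k)%nat).
Proof.
  intros H Hm; unfold sine_series; rewrite (Series_tail _ N); [|now apply ex_sine_series with m].
  replace (_ + _ - _) with (Series (fun k => c (S N + k)%nat * sn (S N + k) x)) by ring.
  assert (Hm' : ex_series (fun k => m (S N + k)%nat)) by now apply ex_series_incr_n.
  assert (Hb : forall k, Rabs (c (S N + k)%nat * sn (S N + k) x) <= m (S N + k)%nat)
    by (intros k; now apply sine_term_bound).
  eapply Rle_trans; [apply Series_Rabs|].
  - apply (ex_series_le (V := R_CompleteNormedModule) _ _) with (2 := Hm').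
    intros k; change (Rabs (Rabs (c (S N + k)%nat * sn (S N + k) x)) <= m (S N + k)%nat).
    rewrite Rabs_Rabsolu; apply Hb.
  - apply Series_le; [|assumption]; intros k; split; [apply Rabs_pos|apply Hb].
Qed.

Lemma time_continuous_sum_n (v : nat -> R -> R -> R) (N : nat) :
  (forall k, time_continuous (v k)) -> time_continuous (fun x t => sum_n (fun k => v k x t) N).
Proof.
  intros H; induction N as [|N IH].
  - destruct (H 0%nat) as [H1 H2]; split.
    + intros t x; apply (continuous_ext (fun y => v 0%nat y t)); [intros y; now rewrite sum_O|apply H1].
    + intros t eps Heps; destruct (H2 t eps Heps) as [d [Hd Hd']]; exists d; split; [assumption|].
      intros s Hs x; rewrite !sum_O; auto.
  - destruct (time_continuous_plus _ _ IH (H (S N))) as [H1 H2]; split.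
    + intros t x; eapply continuous_ext; [|apply (H1 t)]; intros y; now rewrite sum_Sn.
    + intros t eps Heps; destruct (H2 t eps Heps) as [d [Hd Hd']]; exists d; split; [assumption|].
      intros s Hs x; rewrite !sum_Sn; apply (Hd' s Hs).
Qed.

(** Weierstrass test: the majorant [m] does not depend on [t], so the partial sums converge
    uniformly in [x] and [t]. *)
Lemma time_continuous_sine_series (c : nat -> R -> R) (m : nat -> R) :
  (forall k t, continuous (c k) t) -> (forall k t, Rabs (c k t) <= m k) -> ex_series m ->
  time_continuous (fun x t => sine_series (fun k => c k t) x).
Proof.
  intros Hc Hb Hm; apply time_continuous_unif_limit; intros eps Heps.
  destruct (Series_tail_small m eps) as [N HN]; [assumption| |assumption|].
  - intros k; apply Rle_trans with (2 := Hb k 0), Rabs_pos.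
  - exists (fun x t => sum_n (fun k => c k t * sn k x) N); split.
    + apply (time_continuous_sum_n (fun k x t => c k t * sn k x)); intros k; now apply time_continuous_mode.
    + intros x t; apply Rle_trans with (Series (fun k => m (S N + k)%nat)).
      * now apply (sine_series_remainder (fun k => c k t)).
      * now apply Rlt_le, HN.
Qed.

Lemma sine_series_continuous (c m : nat -> R) (x : R) :
  (forall k, Rabs (c k) <= m k) -> ex_series m -> continuous (sine_series c) x.
Proof.
  intros Hc Hm.
  destruct (time_continuous_sine_series (fun k _ => c k) m) as [H _]; auto.
  intros k t; apply continuous_const.
Qed.

Lemma sine_series_0 (c : nat -> R) : sine_series c 0 = 0.
Proof.
  unfold sine_series; rewrite (Series_ext _ (fun _ => 0 * 0)).
  - rewrite Series_scal_l; ring.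
  - intros k; rewrite sn_0; ring.
Qed.

Lemma sine_series_1 (c : nat -> R) : sine_series c 1 = 0.
Proof.
  unfold sine_series; rewrite (Series_ext _ (fun _ => 0 * 0)).
  - rewrite Series_scal_l; ring.
  - intros k; rewrite sn_1; ring.
Qed.

Definition sine_poly (c : nat -> R) (N : nat) (x : R) : R := sum_n (fun k => c k * sn k x) N.

Lemma sine_poly_continuous (c : nat -> R) (N : nat) (x : R) : continuous (sine_poly c N) x.
Proof.
  destruct (time_continuous_sum_n (fun k x _ => c k * sn k x) N) as [H _].
  - intros k; apply (time_continuous_mode (fun _ => c k)); intros t; apply continuous_const.
  - exact (H 0 x).
Qed.

Lemma coef_sine_poly (c : nat -> R) (N k : nat) :
  coef (sine_poly c N) k = if Nat.leb k N then c k else 0.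
Proof.
  induction N as [|N IH].
  - rewrite (coef_ext _ (fun x => 0 + c 0%nat * sn 0 x)).
    + rewrite coef_linear, coef_sn; [|intros; apply continuous_const|apply sn_continuous].
      assert (E : coef (fun _ => 0) k = 0).
      { unfold coef; rewrite (RInt_ext _ (fun _ => 0)) by (intros; apply Rmult_0_l).
        rewrite RInt_const; unfold scal; simpl; unfold mult; simpl; ring. }
      rewrite E; destruct k; simpl; ring.
    + intros x _; unfold sine_poly; rewrite sum_O; ring.
  - rewrite (coef_ext _ (fun x => sine_poly c N x + c (S N) * sn (S N) x)).
    + rewrite coef_linear, coef_sn, IH; [|apply sine_poly_continuous|apply sn_continuous].
      destruct (Nat.eqb_spec (S N) k) as [<-|Hk].
      * rewrite (proj2 (Nat.leb_gt _ _)), (proj2 (Nat.leb_le _ _)) by lia; ring.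
      * destruct (Nat.leb_spec k N).
        -- rewrite (proj2 (Nat.leb_le _ _)) by lia; ring.
        -- rewrite (proj2 (Nat.leb_gt _ _)) by lia; ring.
    + intros x _; unfold sine_poly; now rewrite sum_Sn.
Qed.

(** A partial sum that already contains mode [k] has the exact coefficient, and the uniformly small
    remainder changes it by at most twice its sup norm. *)
Lemma coef_sine_series (c m : nat -> R) (k : nat) :
  (forall k, Rabs (c k) <= m k) -> ex_series m -> coef (sine_series c) k = c k.
Proof.
  intros Hc Hm; apply Rminus_diag_uniq, Rabs_eq_0.
  apply Rle_antisym; [|apply Rabs_pos]; apply le_epsilon; intros eps Heps; rewrite Rplus_0_l.
  destruct (Series_tail_small m (eps / 2)) as [N HN]; [assumption| |lra|].
  - intros j; apply Rle_trans with (2 := Hc j), Rabs_pos.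
  - set (N' := Nat.max N k).
    assert (E := coef_sine_poly c N' k).
    rewrite (proj2 (Nat.leb_le _ _)) in E by (unfold N'; lia); rewrite <- E.
    apply Rle_trans with (2 * (eps / 2)); [|lra].
    apply coef_dist.
    + intros x; now apply sine_series_continuous with m.
    + apply sine_poly_continuous.
    + intros x _; apply Rle_trans with (1 := sine_series_remainder c m x N' Hc Hm).
      apply Rlt_le, HN; unfold N'; lia.
Qed.

(** * Maximum principle *)

(** For [A = 0] and [B = 1] this is literally the continuity clause of [parabolic_solution], so that
    [change] converts one into the other. *)
Definition cont_rect (v : R -> R -> R) (A B T : R) : Prop :=
  forall x t, A <= x <= B -> 0 <= t <= T -> forall eps, 0 < eps ->
    exists delta, 0 < delta /\ forall y s, A <= y <= B -> 0 <= s <= T ->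
      Rabs (y - x) < delta -> Rabs (s - t) < delta -> Rabs (v y s - v x t) < eps.

Lemma cont_rect_clamp (v : R -> R -> R) (A B T : R) :
  A <= B -> 0 <= T -> cont_rect v A B T ->
  forall x t, continuity_2d_pt (fun x t => v (clamp A B x) (clamp 0 T t)) x t.
Proof.
  intros HAB HT H x t eps.
  destruct (H (clamp A B x) (clamp 0 T t) (clamp_bounds _ _ _ HAB)
              (clamp_bounds _ _ _ HT) eps (cond_pos eps)) as [d [Hd Hd']].
  exists (mkposreal d Hd); simpl; intros y s Hy Hs; apply Hd'; auto using clamp_bounds.
  - apply Rle_lt_trans with (1 := clamp_lipschitz A B y x); assumption.
  - apply Rle_lt_trans with (1 := clamp_lipschitz 0 T s t); assumption.
Qed.

(** Maximize in [x] first, then in [t]. The chosen maximizer [X t] need not be continuous in [t],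
    but the value [Z (X t) t] is, by uniform continuity of [Z] on a compact rectangle around [t]. *)
Lemma rect_max (Z : R -> R -> R) (A B T : R) :
  A <= B -> 0 <= T -> (forall x t, continuity_2d_pt Z x t) ->
  exists x0 t0, A <= x0 <= B /\ 0 <= t0 <= T /\
    forall x t, A <= x <= B -> 0 <= t <= T -> Z x t <= Z x0 t0.
Proof.
  intros HAB HT HZ.
  assert (Hx : forall t, exists x0, (forall x, A <= x <= B -> Z x t <= Z x0 t) /\ A <= x0 <= B).
  { intros t; apply (continuity_ab_maj (fun x => Z x t)); [assumption|].
    intros x _; apply continuity_pt_of_continuous, continuous_eps; intros eps Heps.
    destruct (HZ x t (mkposreal eps Heps)) as [d Hd].
    exists d; split; [apply cond_pos|]; intros y Hy; apply Hd; [assumption|].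
    rewrite Rminus_diag, Rabs_R0; apply cond_pos. }
  pose (X := fun t => proj1_sig (constructive_indefinite_description _ (Hx t))).
  assert (HX : forall t, (forall x, A <= x <= B -> Z x t <= Z (X t) t) /\ A <= X t <= B)
    by (intros t; exact (proj2_sig (constructive_indefinite_description _ (Hx t)))).
  destruct (continuity_ab_maj (fun t => Z (X t) t) 0 T) as [t0 [Ht0 Ht0']].
  - assumption.
  - intros t Ht; apply continuity_pt_of_continuous, continuous_eps; intros eps Heps.
    destruct (uniform_continuity_2d Z A B (t - 1) (t + 1) (fun x s _ _ => HZ x s)
      (mkposreal eps Heps)) as [d Hd]; simpl in Hd.
    assert (Hd1 : forall x s, A <= x <= B -> Rabs (s - t) < Rmin d 1 -> Rabs (Z x s - Z x t) < eps).
    { intros x s Hx' Hs; apply Hd; try assumption.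
      - lra.
      - assert (Hs1 := Rlt_le_trans _ _ _ Hs (Rmin_r _ _)); revert Hs1.
        unfold Rabs; destruct Rcase_abs; lra.
      - rewrite Rminus_diag, Rabs_R0; apply cond_pos.
      - exact (Rlt_le_trans _ _ _ Hs (Rmin_l _ _)). }
    exists (Rmin d 1); split; [apply Rmin_glb_lt; [apply cond_pos|lra]|]; intros s Hs.
    destruct (HX s) as [Hs1 Hs2]; destruct (HX t) as [Ht1 Ht2].
    generalize (Hd1 _ s Hs2 Hs) (Hd1 _ s Ht2 Hs) (Hs1 _ Ht2) (Ht1 _ Hs2).
    unfold Rabs; repeat destruct Rcase_abs; lra.
  - exists (X t0), t0; split; [apply HX|]; split; [assumption|]; intros x t Hx' Ht.
    apply Rle_trans with (2 := Ht0 t Ht); now apply HX.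
Qed.

(** Only earlier times are compared, because a maximum over a time interval may sit at its final
    time. *)
Lemma derive_left_max (f : R -> R) (t l d : R) :
  is_derive f t l -> 0 < d -> (forall s, t - d < s < t -> f s <= f t) -> 0 <= l.
Proof.
  intros Hf Hd H; apply is_derive_Reals in Hf.
  destruct (Rle_lt_dec 0 l) as [|Hl]; [assumption|exfalso].
  destruct (Hf (- l)) as [[e He] He']; [lra|]; simpl in He'.
  set (h := Rmin d e / 2).
  assert (Hh : 0 < h /\ h < d /\ h < e).
  { unfold h; pose proof (Rmin_l d e); pose proof (Rmin_r d e).
    pose proof (Rmin_glb_lt d e 0 Hd He); lra. }
  specialize (He' (- h)); specialize (H (t + - h)).
  assert (Hq : 0 <= (f (t + - h) - f t) / - h).
  { replace ((f (t + - h) - f t) / - h) with ((f t - f (t + - h)) / h) by (field; lra).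
    apply Rdiv_le_0_compat; [|lra]; cut (f (t + - h) <= f t); [lra|apply H; lra]. }
  assert (Hlt : Rabs ((f (t + - h) - f t) / - h - l) < - l).
  { apply He'; [lra|]; rewrite Rabs_Ropp, Rabs_right; lra. }
  revert Hlt; unfold Rabs; destruct Rcase_abs; lra.
Qed.

Lemma derive_right_max (f : R -> R) (t l d : R) :
  is_derive f t l -> 0 < d -> (forall s, t < s < t + d -> f s <= f t) -> l <= 0.
Proof.
  intros Hf Hd H.
  cut (0 <= - l); [lra|].
  apply (derive_left_max (fun s => f (- s)) (- t) (- l) d); [|assumption|].
  - assert (Hc := is_derive_comp (V := R_NormedModule) f (fun s => - s) (- t) l (-1)).
    replace (- l) with (scal (-1) l) by (unfold scal; simpl; unfold mult; simpl; ring).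
    apply Hc; [now rewrite Ropp_involutive|]; auto_derive; auto.
  - intros s Hs; rewrite Ropp_involutive; apply H; lra.
Qed.

(** The first derivative vanishes at [x]; if [l] were positive, [f1] would be positive just to the
    right and the mean value theorem would make [f] exceed its maximum. *)
Lemma second_derive_max (f f1 : R -> R) (x l d : R) :
  0 < d -> (forall y, x - d < y < x + d -> is_derive f y (f1 y)) -> is_derive f1 x l ->
  (forall y, x - d < y < x + d -> f y <= f x) -> l <= 0.
Proof.
  intros Hd Hf Hf1 Hmax.
  assert (H0 : f1 x = 0).
  { apply Rle_antisym.
    - apply (derive_right_max f x _ d); [apply Hf; lra|assumption|]; intros; apply Hmax; lra.
    - apply (derive_left_max f x _ d); [apply Hf; lra|assumption|]; intros; apply Hmax; lra. }
  destruct (Rle_lt_dec l 0) as [|Hl]; [assumption|exfalso].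
  apply is_derive_Reals in Hf1; destruct (Hf1 l Hl) as [[e He] He']; simpl in He'.
  set (h := Rmin d e / 2).
  assert (Hh : 0 < h /\ h < d /\ h < e).
  { unfold h; pose proof (Rmin_l d e); pose proof (Rmin_r d e).
    pose proof (Rmin_glb_lt d e 0 Hd He); lra. }
  assert (Hpos : forall y, x < y < x + e -> 0 < f1 y).
  { intros y Hy; specialize (He' (y - x)).
    assert (Hq : Rabs ((f1 (x + (y - x)) - f1 x) / (y - x) - l) < l)
      by (apply He'; [lra|rewrite Rabs_right; lra]).
    replace (x + (y - x)) with y in Hq by ring; rewrite H0, Rminus_0_r in Hq.
    assert (Hq' : 0 < f1 y / (y - x)) by (revert Hq; unfold Rabs; destruct Rcase_abs; lra).
    replace (f1 y) with (f1 y / (y - x) * (y - x)) by (field; lra).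
    apply Rmult_lt_0_compat; lra. }
  destruct (MVT_cor2 f f1 x (x + h)) as [c [Hc Hc']]; [lra| |].
  - intros c Hc; apply is_derive_Reals, Hf; lra.
  - assert (Hfc := Hpos c ltac:(lra)); assert (Hfx := Hmax (x + h) ltac:(lra)); nra.
Qed.

(* At a positive maximum of [exp (- (C + 1) t) v] over the rectangle one would have
   [v_t - v_xx >= (C + 1) v]. *)
Lemma max_principle (v vt vx vxx : R -> R -> R) (A B T C : R) :
  A < B -> 0 < T -> cont_rect v A B T ->
  (forall x t, A < x < B -> 0 < t < T ->
     is_derive (fun s => v x s) t (vt x t) /\ is_derive (fun y => v y t) x (vx x t) /\
     is_derive (fun y => vx y t) x (vxx x t)) ->
  (forall x t, A < x < B -> 0 < t < T -> 0 < v x t -> vt x t - vxx x t <= C * v x t) ->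
  (forall x, A <= x <= B -> v x 0 <= 0) ->
  (forall t, 0 <= t <= T -> v A t <= 0 /\ v B t <= 0) ->
  forall x t, A <= x <= B -> 0 <= t <= T -> v x t <= 0.
Proof.
  intros HAB HT Hc Hder Hpde Hini Hbd.
  (* The equation is assumed only for [t < T], so the maximum is taken over [[0, t1]] with [t1 < T].
     The final time [T] follows by continuity. *)
  assert (Hmain : forall x t, A <= x <= B -> 0 <= t < T -> v x t <= 0).
  { intros x1 t1 Hx1 Ht1; destruct (Rle_lt_dec (v x1 t1) 0) as [|Hv1]; [assumption|exfalso].
    set (V := fun x t => v (clamp A B x) (clamp 0 T t)).
    assert (HV : forall x t, A <= x <= B -> 0 <= t <= T -> V x t = v x t)
      by (intros x t Hx Ht; unfold V; now rewrite !clamp_id).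
    set (Z := fun x t => exp (- (C + 1) * t) * V x t).
    destruct (rect_max Z A B t1) as [xs [ts [Hxs [Hts Hmax]]]]; [lra|lra| |].
    { intros x t; unfold Z; apply continuity_2d_pt_mult.
      - apply (continuity_1d_2d_pt_comp exp (fun _ t => - (C + 1) * t)).
        + apply derivable_continuous_pt, derivable_pt_exp.
        + apply continuity_2d_pt_mult; [apply continuity_2d_pt_const|apply continuity_2d_pt_id2].
      - apply cont_rect_clamp; [lra|lra|assumption]. }
    assert (HZ1 : 0 < Z x1 t1)
      by (unfold Z; rewrite HV by lra; apply Rmult_lt_0_compat; [apply exp_pos|assumption]).
    assert (HZs : 0 < Z xs ts) by (apply Rlt_le_trans with (1 := HZ1), Hmax; lra).
    assert (Hvs : 0 < v xs ts).
    { unfold Z in HZs; rewrite HV in HZs by lra; pose proof (exp_pos (- (C + 1) * ts)); nra. }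
    assert (Hts' : 0 < ts).
    { destruct (Req_dec ts 0) as [E|E]; [|lra]; rewrite E in Hvs.
      specialize (Hini xs Hxs); lra. }
    assert (Hbs := Hbd ts ltac:(lra)).
    assert (HxA : xs <> A) by (intros E; rewrite E in Hvs; lra).
    assert (HxB : xs <> B) by (intros E; rewrite E in Hvs; lra).
    destruct (Hder xs ts) as [Dt [Dx Dxx]]; [lra|lra|].
    assert (H1 : 0 <= exp (- (C + 1) * ts) * (vt xs ts - (C + 1) * v xs ts)).
    { apply (derive_left_max (fun s => exp (- (C + 1) * s) * v xs s) ts _ ts); [|assumption|].
      - assert (De : is_derive (fun s => exp (- (C + 1) * s)) ts (- (C + 1) * exp (- (C + 1) * ts)))
          by (auto_derive; [auto|ring]).
        assert (Dm := is_derive_mult _ _ _ _ _ De Dt Rmult_comm).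
        replace (exp _ * _) with (plus (mult (- (C + 1) * exp (- (C + 1) * ts)) (v xs ts))
          (mult (exp (- (C + 1) * ts)) (vt xs ts))); [exact Dm|].
        unfold plus, mult; simpl; ring.
      - intros s Hs; generalize (Hmax xs s Hxs ltac:(lra)); unfold Z; now rewrite !HV by lra. }
    assert (H2 : vxx xs ts <= 0).
    { set (d := Rmin (xs - A) (B - xs)).
      assert (Hd : 0 < d) by (apply Rmin_glb_lt; lra).
      assert (Hd1 : d <= xs - A) by apply Rmin_l.
      assert (Hd2 : d <= B - xs) by apply Rmin_r.
      apply (second_derive_max (fun y => v y ts) (fun y => vx y ts) xs _ d); [assumption| |assumption|].
      - intros y Hy; apply Hder; lra.
      - intros y Hy; generalize (Hmax y ts ltac:(lra) ltac:(lra)); unfold Z.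
        rewrite !HV by lra; apply Rmult_le_reg_l, exp_pos. }
    specialize (Hpde xs ts ltac:(lra) ltac:(lra) Hvs).
    pose proof (exp_pos (- (C + 1) * ts)); nra. }
  intros x t Hx Ht; destruct (Req_dec t T) as [->|Hne]; [|apply Hmain; lra].
  apply le_epsilon; intros eps Heps; rewrite Rplus_0_l.
  destruct (Hc x T Hx ltac:(lra) eps Heps) as [d [Hd Hd']].
  set (s := Rmax 0 (T - d / 2)).
  assert (Hs : 0 <= s < T) by (unfold s; split; [apply Rmax_l|apply Rmax_lub_lt; lra]).
  assert (Hs' : T - d / 2 <= s) by apply Rmax_r.
  assert (Hlt := Hd' x s Hx ltac:(lra)).
  rewrite Rminus_diag, Rabs_R0 in Hlt; specialize (Hlt Hd).
  assert (Hlt' : Rabs (v x s - v x T) < eps) by (apply Hlt; rewrite Rabs_left; lra).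
  specialize (Hmain x s Hx Hs); revert Hlt'; unfold Rabs; destruct Rcase_abs; lra.
Qed.

(** * Density of sine polynomials *)

(** The last constructor closes the span under pointwise equality and so stands in for functional
    extensionality. *)
Inductive sine_span : (R -> R) -> Prop :=
| sine_span_mode (k : nat) : sine_span (sn k)
| sine_span_linear (f g : R -> R) (c : R) :
    sine_span f -> sine_span g -> sine_span (fun x => f x + c * g x)
| sine_span_ext (f g : R -> R) : sine_span f -> (forall x, f x = g x) -> sine_span g.

Lemma sine_span_scal (f : R -> R) (c : R) : sine_span f -> sine_span (fun x => c * f x).
Proof.
  intros Hf; apply sine_span_ext with (fun x => f x + (c - 1) * f x); [|intros; ring].
  now apply sine_span_linear.
Qed.

(** The span is thus a module over the polynomials in [cos (PI * x)], which is how polynomial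
    approximation enters. For [k = 0] the lower neighbour of the mode is [sin 0], hence the separate
    case. *)
Lemma sine_span_cos (f : R -> R) : sine_span f -> sine_span (fun x => f x * cos (PI * x)).
Proof.
  induction 1 as [k|f g c Hf IHf Hg IHg|f g Hf IHf Hfg].
  - destruct k as [|k].
    + apply sine_span_ext with (fun x => / 2 * sn 1 x).
      * apply sine_span_scal, sine_span_mode.
      * intros x; unfold sn; simpl INR.
        replace ((1 + 1) * PI * x) with (2 * (PI * x)) by ring.
        rewrite sin_2a, Rmult_1_l; field.
    + apply sine_span_ext with (fun x => / 2 * sn (S (S k)) x + / 2 * sn k x).
      * apply sine_span_linear; [apply sine_span_scal|]; apply sine_span_mode.
      * intros x; unfold sn; rewrite !S_INR.
        replace ((INR k + 1 + 1 + 1) * PI * x) with ((INR k + 1 + 1) * PI * x + PI * x) by ring.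
        replace ((INR k + 1) * PI * x) with ((INR k + 1 + 1) * PI * x - PI * x) by ring.
        rewrite sin_plus, sin_minus; field.
  - eapply sine_span_ext; [apply (sine_span_linear _ _ c IHf IHg)|]; intros x; simpl; ring.
  - eapply sine_span_ext; [apply IHf|]; intros x; simpl; now rewrite Hfg.
Qed.

Lemma sine_span_continuous (f : R -> R) : sine_span f -> forall x, continuous f x.
Proof.
  induction 1 as [k|f g c Hf IHf Hg IHg|f g Hf IHf Hfg]; intros x.
  - apply sn_continuous.
  - apply (continuous_plus f (fun x => c * g x)); [apply IHf|].
    apply (continuous_mult (fun _ => c) g); [apply continuous_const|apply IHg].
  - apply (continuous_ext f); auto.
Qed.

(* Expectation of [g (j + S)] for a binomial variable [S] with parameters [n] and [y]:
   the Bernstein polynomials without binomial coefficients. *)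
Fixpoint bernstein (y : R) (n : nat) (g : nat -> R) (j : nat) : R :=
  match n with
  | O => g j
  | S n' => y * bernstein y n' g (S j) + (1 - y) * bernstein y n' g j
  end.

(** Mean [n y] and variance [n y (1 - y)] of the binomial law, obtained by induction without any
    binomial coefficient. *)
Lemma bernstein_square (y alpha beta s : R) (n j : nat) :
  bernstein y n (fun i => alpha + beta * (INR i - s) ^ 2) j
  = alpha + beta * ((INR j + INR n * y - s) ^ 2 + INR n * (y * (1 - y))).
Proof.
  revert j; induction n as [|n IH]; intros j; cbn [bernstein].
  - simpl INR; ring.
  - rewrite !IH, !S_INR; ring.
Qed.

Lemma bernstein_dist (y c : R) (n : nat) (g G : nat -> R) (j : nat) :
  0 <= y <= 1 -> (forall i, (j <= i <= j + n)%nat -> Rabs (g i - c) <= G i) ->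
  Rabs (bernstein y n g j - c) <= bernstein y n G j.
Proof.
  intros Hy; revert j; induction n as [|n IH]; intros j H; cbn [bernstein].
  - apply H; lia.
  - replace (_ + _ - c) with (y * (bernstein y n g (S j) - c) + (1 - y) * (bernstein y n g j - c))
      by ring.
    apply Rle_trans with (1 := Rabs_triang _ _).
    rewrite !Rabs_mult, (Rabs_right y), (Rabs_right (1 - y)) by lra.
    apply Rplus_le_compat; apply Rmult_le_compat_l; try lra; apply IH; intros i Hi; apply H; lia.
Qed.

Lemma sine_span_bernstein (n : nat) (g : nat -> R) (j : nat) :
  sine_span (fun x => sn 0 x * bernstein ((1 - cos (PI * x)) / 2) n g j).
Proof.
  revert j; induction n as [|n IH]; intros j; cbn [bernstein].
  - eapply sine_span_ext; [exact (sine_span_scal _ (g j) (sine_span_mode 0))|].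
    intros x; simpl; ring.
  - eapply sine_span_ext.
    (* With [y = (1 - cos (PI * x)) / 2] the recursion is half the sum of the two previous
       polynomials plus half of the cosine times their difference. *)
    + exact (sine_span_linear _ _ 1
        (sine_span_linear _ _ (/ 2) (sine_span_scal _ (/ 2) (IH j)) (IH (S j)))
        (sine_span_linear _ _ (/ 2) (sine_span_scal _ (- / 2) (sine_span_cos _ (IH (S j))))
           (sine_span_cos _ (IH j)))).
    + intros x; simpl; field.
Qed.

Lemma sin_PI_lower (d z : R) : 0 <= d -> d <= z <= 1 - d -> sin (PI * d) <= sin (PI * z).
Proof.
  intros Hd Hz; pose proof PI_RGT_0 as HPI.
  destruct (Rle_lt_dec z (1 / 2)) as [H|H].
  - apply sin_incr_1; nra.
  - replace (sin (PI * z)) with (sin (PI * (1 - z))).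
    + apply sin_incr_1; nra.
    + replace (PI * (1 - z)) with (PI - PI * z) by ring; apply sin_PI_x.
Qed.

Lemma continuous_bounded (h : R -> R) (a b : R) :
  a <= b -> (forall x, continuous h x) -> exists M, forall x, a <= x <= b -> Rabs (h x) <= M.
Proof.
  intros Hab Hh.
  destruct (continuity_ab_maj (fun x => Rabs (h x)) a b Hab) as [x0 [H _]].
  - intros c _; apply continuity_pt_of_continuous.
    apply (continuous_comp h Rabs); [apply Hh|apply continuous_Rabs].
  - now exists (Rabs (h x0)).
Qed.

(** The difference of cosines is twice the product of the sines of the half difference and the half
    sum. Both half arguments lie in [[d / 2, 1 - d / 2]] before multiplication by [PI], so each sine
    is at least [sin (PI * (d / 2))]. *)
Lemma cos_PI_separation (d x x' : R) :
  0 < d -> 0 <= x <= 1 -> 0 <= x' <= 1 -> d <= Rabs (x - x') ->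
  (sin (PI * (d / 2)) ^ 2) ^ 2
    <= ((1 - cos (PI * x)) / 2 - (1 - cos (PI * x')) / 2) ^ 2.
Proof.
  intros Hd; pose proof PI_RGT_0 as HPI.
  assert (Hw : forall x x', 0 <= x <= 1 -> 0 <= x' <= 1 -> d <= x - x' ->
    (sin (PI * (d / 2)) ^ 2) ^ 2 <= ((1 - cos (PI * x)) / 2 - (1 - cos (PI * x')) / 2) ^ 2).
  { clear x x'; intros x x' Hx Hx' Hdx.
    replace ((1 - cos (PI * x)) / 2 - (1 - cos (PI * x')) / 2)
      with ((cos (PI * x') - cos (PI * x)) / 2) by field.
    rewrite form2.
    replace ((PI * x' - PI * x) / 2) with (- (PI * ((x - x') / 2))) by field.
    replace ((PI * x' + PI * x) / 2) with (PI * ((x + x') / 2)) by field.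
    rewrite sin_neg.
    assert (H0 : 0 <= sin (PI * (d / 2))) by (apply sin_ge_0; nra).
    assert (H1 : sin (PI * (d / 2)) <= sin (PI * ((x - x') / 2))) by (apply sin_PI_lower; lra).
    assert (H2 : sin (PI * (d / 2)) <= sin (PI * ((x + x') / 2))) by (apply sin_PI_lower; lra).
    apply pow_incr; split; [apply pow2_ge_0|]; nra. }
  intros Hx Hx' Hdx; destruct (Rle_lt_dec x' x) as [H|H].
  - apply Hw; try assumption; rewrite Rabs_right in Hdx; lra.
  - replace (((1 - cos (PI * x)) / 2 - (1 - cos (PI * x')) / 2) ^ 2)
      with (((1 - cos (PI * x')) / 2 - (1 - cos (PI * x)) / 2) ^ 2) by ring.
    apply Hw; try assumption; rewrite Rabs_left in Hdx; lra.
Qed.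

(** Inverts the change of variable from [x] to [(1 - cos (PI * x)) / 2]; it locates in [x] the nodes
    [i / N] of the Bernstein polynomial. *)
Lemma bernstein_node (r : R) : 0 <= r <= 1 ->
  0 <= acos (1 - 2 * r) / PI <= 1 /\ (1 - cos (PI * (acos (1 - 2 * r) / PI))) / 2 = r.
Proof.
  intros Hr; pose proof PI_RGT_0 as HPI; pose proof (acos_bound (1 - 2 * r)) as Ha; split.
  - split; [apply Rdiv_le_0_compat; lra|].
    apply Rmult_le_reg_r with PI; [assumption|]; unfold Rdiv; rewrite Rmult_assoc, Rinv_l; lra.
  - replace (PI * (acos (1 - 2 * r) / PI)) with (acos (1 - 2 * r)) by (field; lra).
    rewrite cos_acos by lra; field.
Qed.

(** Bernstein's argument in the variable [y = (1 - cos (PI * x)) / 2]. Nodes within [d] of [x] cost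
    at most [eta / 2] by uniform continuity; for the others [2 * M] is at most [C] times the squared
    distance in [y], and the mean of that square is [y * (1 - y) / N]. *)
Lemma bernstein_approx (H : R -> R) (eta : R) :
  (forall x, continuous H x) -> 0 < eta ->
  exists n g, forall x, 0 <= x <= 1 ->
    Rabs (bernstein ((1 - cos (PI * x)) / 2) n g 0 - H x) <= eta.
Proof.
  intros HH Heta.
  destruct (continuous_bounded H 0 1) as [M HM]; [lra|assumption|].
  assert (HM0 : 0 <= M) by (apply Rle_trans with (2 := HM 0 ltac:(lra)), Rabs_pos).
  destruct (@Heine_cor2 H 0 1 (fun x _ => continuity_pt_of_continuous _ _ (HH x))
    (mkposreal (eta / 2) ltac:(lra))) as [[d0 Hd0] Hd0']; simpl in Hd0'.
  (* The cap at 1 keeps [PI * (d / 2)] below [PI], so that [rho] is positive. *)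
  set (d := Rmin d0 1).
  assert (Hd : 0 < d) by (apply Rmin_glb_lt; lra).
  assert (Hd1 : d <= 1) by apply Rmin_r.
  assert (Hdd : d <= d0) by apply Rmin_l.
  set (rho := (sin (PI * (d / 2)) ^ 2) ^ 2).
  assert (Hrho : 0 < rho).
  { unfold rho; do 2 apply pow_lt; pose proof PI_RGT_0; apply sin_gt_0; nra. }
  set (C := 2 * M / rho).
  assert (HC : 0 <= C) by (apply Rdiv_le_0_compat; lra).
  destruct (archimed_cor1 (eta / 2 / (C + 1))) as [N [HN HN0]].
  { apply Rdiv_lt_0_compat; lra. }
  assert (HNR : 0 < INR N) by (apply lt_0_INR; lia).
  exists N, (fun i => H (acos (1 - 2 * (INR i / INR N)) / PI)); intros x Hx.
  set (y := (1 - cos (PI * x)) / 2).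
  assert (Hy : 0 <= y <= 1) by (unfold y; pose proof (COS_bound (PI * x)); lra).
  apply Rle_trans with (bernstein y N
    (fun i => eta / 2 + C / INR N ^ 2 * (INR i - INR N * y) ^ 2) 0).
  - apply bernstein_dist; [assumption|]; intros i Hi.
    assert (Hr : 0 <= INR i / INR N <= 1).
    { split; [apply Rdiv_le_0_compat; [apply pos_INR|assumption]|].
      apply Rmult_le_reg_r with (INR N); [assumption|]; unfold Rdiv.
      rewrite Rmult_assoc, Rinv_l, Rmult_1_r, Rmult_1_l by lra; apply le_INR; lia. }
    destruct (bernstein_node _ Hr) as [Hx' Ey].
    set (x' := acos (1 - 2 * (INR i / INR N)) / PI) in *.
    replace (C / INR N ^ 2 * (INR i - INR N * y) ^ 2) with (C * (INR i / INR N - y) ^ 2)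
      by (field; lra).
    rewrite <- Ey.
    assert (Hsq : 0 <= C * ((1 - cos (PI * x')) / 2 - y) ^ 2)
      by (apply Rmult_le_pos; [assumption|apply pow2_ge_0]).
    destruct (Rlt_le_dec (Rabs (x' - x)) d) as [Hlt|Hge].
    + specialize (Hd0' x' x Hx' Hx ltac:(lra)); lra.
    + assert (Hsep := cos_PI_separation d x' x Hd Hx' Hx Hge); fold y rho in Hsep.
      assert (HCr : 2 * M = C * rho) by (unfold C; field; lra).
      assert (Hb : Rabs (H x' - H x) <= 2 * M).
      { generalize (HM x Hx) (HM x' Hx'); unfold Rabs; repeat destruct Rcase_abs; lra. }
      nra.
  - rewrite bernstein_square; simpl (INR 0).
    replace (0 + INR N * y - INR N * y) with 0 by ring.
    replace (C / INR N ^ 2 * (0 ^ 2 + INR N * (y * (1 - y)))) with ((C * / INR N) * (y * (1 - y)))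
      by (field; lra).
    assert (Hyy : 0 <= y * (1 - y) <= 1) by nra.
    assert (Hinv : 0 < / INR N) by now apply Rinv_0_lt_compat.
    assert (Hfin : C * / INR N <= eta / 2).
    { apply Rle_trans with ((C + 1) * (eta / 2 / (C + 1))); [|right; field; lra]; nra. }
    assert (H0 : 0 <= C * / INR N) by (apply Rmult_le_pos; lra); nra.
Qed.

(** Divide [h] by [sn 0], approximate the quotient by a polynomial in the cosine, and multiply by
    [sn 0] again to land in the span. The divisor is kept above [rho = sin (PI * d)]; this alters
    the quotient only within [d] of the ends, where [h] itself is at most [eta / 2] in absolute
    value. *)
Lemma sine_weierstrass (h : R -> R) (eta : R) :
  (forall x, continuous h x) -> h 0 = 0 -> h 1 = 0 -> 0 < eta ->
  exists p, sine_span p /\ forall x, 0 <= x <= 1 -> Rabs (h x - p x) <= eta.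
Proof.
  intros Hh H0 H1 Heta; pose proof PI_RGT_0 as HPI.
  destruct (proj1 (continuous_eps _ _) (Hh 0) (eta / 2)) as [d0 [Hd0 Hd0']]; [lra|].
  destruct (proj1 (continuous_eps _ _) (Hh 1) (eta / 2)) as [d1 [Hd1 Hd1']]; [lra|].
  rewrite H0 in Hd0'; rewrite H1 in Hd1'.
  set (d := Rmin (Rmin d0 d1) (1 / 2)).
  assert (Hd : 0 < d) by (repeat apply Rmin_glb_lt; lra).
  assert (Hdle : d <= d0 /\ d <= d1 /\ d <= 1 / 2).
  { unfold d; generalize (Rmin_l (Rmin d0 d1) (1 / 2)) (Rmin_r (Rmin d0 d1) (1 / 2))
      (Rmin_l d0 d1) (Rmin_r d0 d1); lra. }
  set (rho := sin (PI * d)).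
  assert (Hrho : 0 < rho) by (apply sin_gt_0; nra).
  assert (Hmax : forall x, 0 < Rmax (sn 0 x) rho)
    by (intros x; apply Rlt_le_trans with (1 := Hrho), Rmax_r).
  set (H := fun x => h x * / Rmax (sn 0 x) rho).
  assert (HH : forall x, continuous H x).
  { intros x; apply (continuous_mult h (fun x => / Rmax (sn 0 x) rho)); [apply Hh|].
    apply (continuous_comp (fun x => Rmax (sn 0 x) rho) Rinv).
    - apply (continuous_comp (sn 0) (fun r => Rmax r rho)); [apply sn_continuous|].
      apply (lipschitz_continuous _ 1); intros a b.
      unfold Rmax, Rabs; repeat destruct Rle_dec; repeat destruct Rcase_abs; lra.
    - apply continuous_Rinv; specialize (Hmax x); lra. }
  destruct (bernstein_approx H (eta / 2) HH) as [n [g Hg]]; [lra|].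
  exists (fun x => sn 0 x * bernstein ((1 - cos (PI * x)) / 2) n g 0); split.
  { apply sine_span_bernstein. }
  intros x Hx; specialize (Hg x Hx); set (b := bernstein _ _ _ _) in *.
  assert (Es : sn 0 x = sin (PI * x)) by (unfold sn; simpl INR; now rewrite Rmult_1_l).
  assert (Hs : 0 <= sn 0 x <= 1).
  { rewrite Es; pose proof (SIN_bound (PI * x)); split; [apply sin_ge_0; nra|lra]. }
  assert (HsH : Rabs (h x - sn 0 x * H x) <= eta / 2).
  { unfold H; destruct (Rle_lt_dec rho (sn 0 x)) as [Hle|Hlt].
    - rewrite Rmax_left by assumption.
      replace (h x - _) with 0 by (field; lra); rewrite Rabs_R0; lra.
    - rewrite Rmax_right by lra.
      replace (h x - sn 0 x * (h x * / rho)) with (h x * (1 - sn 0 x * / rho)) by (field; lra).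
      assert (Hhx : Rabs (h x) <= eta / 2).
      { destruct (Rlt_le_dec x d) as [Hxd|Hxd].
        - specialize (Hd0' x); rewrite !Rminus_0_r in Hd0'.
          apply Rlt_le, Hd0'; rewrite Rabs_right; lra.
        - destruct (Rlt_le_dec (1 - d) x) as [Hxd'|Hxd'].
          + specialize (Hd1' x); rewrite Rminus_0_r in Hd1'.
            apply Rlt_le, Hd1'; rewrite Rabs_left1; lra.
          + exfalso; assert (Hsl := sin_PI_lower d x ltac:(lra) ltac:(lra)).
            rewrite <- Es in Hsl; unfold rho in Hlt; lra. }
      assert (Hq : 0 <= sn 0 x * / rho <= 1).
      { assert (Hi := Rinv_0_lt_compat _ Hrho); split; [apply Rmult_le_pos; lra|].
        apply Rle_trans with (rho * / rho); [apply Rmult_le_compat_r; lra|rewrite Rinv_r; lra]. }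
      rewrite Rabs_mult, (Rabs_right (1 - _)) by lra; pose proof (Rabs_pos (h x)); nra. }
  replace (h x - sn 0 x * b) with ((h x - sn 0 x * H x) - sn 0 x * (b - H x)) by ring.
  apply Rle_trans with (1 := Rabs_triang _ _); rewrite Rabs_Ropp, Rabs_mult, (Rabs_right (sn 0 x)) by lra.
  pose proof (Rabs_pos (b - H x)); nra.
Qed.

Lemma coef_zero_span (f p : R -> R) :
  (forall x, continuous f x) -> (forall k, coef f k = 0) -> sine_span p ->
  RInt (fun x => f x * p x) 0 1 = 0.
Proof.
  intros Hf H0 Hp; induction Hp as [k|g h c Hg IHg Hh IHh|g h Hg IHg Hgh].
  - specialize (H0 k); unfold coef in H0; lra.
  - assert (Hex : forall q, sine_span q -> ex_RInt (fun x => f x * q x) 0 1).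
    { intros q Hq; apply (ex_RInt_continuous (V := R_CompleteNormedModule)); intros x _.
      apply (continuous_mult f q); [apply Hf|now apply sine_span_continuous]. }
    rewrite (RInt_ext _ (fun x => plus (f x * g x) (scal c (f x * h x)))).
    + rewrite (RInt_plus (V := R_CompleteNormedModule)), (RInt_scal (V := R_CompleteNormedModule));
        auto; [|now apply (ex_RInt_scal (V := R_NormedModule)), Hex].
      rewrite IHg, IHh; unfold plus, scal; simpl; unfold mult; simpl; ring.
    + intros x _; unfold plus, scal; simpl; unfold mult; simpl; ring.
  - etransitivity; [|exact IHg]; apply RInt_ext; intros x _; now rewrite Hgh.
Qed.

Lemma RInt_square_pos (f : R -> R) (x0 : R) :
  (forall x, continuous f x) -> 0 <= x0 <= 1 -> f x0 <> 0 -> 0 < RInt (fun x => f x * f x) 0 1.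
Proof.
  intros Hf Hx0 H0.
  assert (Hff : forall x, continuous (fun x => f x * f x) x)
    by (intros x; apply (continuous_mult f f); auto).
  assert (Hex : forall a b, ex_RInt (fun x => f x * f x) a b)
    by (intros a b; apply (ex_RInt_continuous (V := R_CompleteNormedModule)); auto).
  assert (Hc : 0 < f x0 * f x0) by nra.
  destruct (proj1 (continuous_eps _ _) (Hff x0) (f x0 * f x0) Hc) as [d [Hd Hd']].
  set (p := Rmax 0 (x0 - d / 2)); set (q := Rmin 1 (x0 + d / 2)).
  assert (Hp : 0 <= p /\ x0 - d / 2 <= p <= x0)
    by (unfold p, Rmax; destruct Rle_dec; lra).
  assert (Hq : q <= 1 /\ x0 <= q <= x0 + d / 2)
    by (unfold q, Rmin; destruct Rle_dec; lra).
  assert (Hpq : p < q).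
  { unfold p, q, Rmax, Rmin; repeat destruct Rle_dec; lra. }
  rewrite <- (RInt_Chasles (V := R_CompleteNormedModule) _ 0 p 1) by auto.
  rewrite <- (RInt_Chasles (V := R_CompleteNormedModule) _ p q 1) by auto.
  unfold plus; simpl.
  assert (H1 : 0 <= RInt (fun x => f x * f x) 0 p) by (apply RInt_ge_0; auto; [lra|]; intros; nra).
  assert (H3 : 0 <= RInt (fun x => f x * f x) q 1) by (apply RInt_ge_0; auto; [lra|]; intros; nra).
  assert (H2 : 0 < RInt (fun x => f x * f x) p q).
  { apply RInt_gt_0; auto; intros x Hx.
    assert (Hlt : Rabs (x - x0) < d) by (unfold Rabs; destruct Rcase_abs; lra).
    specialize (Hd' x Hlt); revert Hd'; unfold Rabs; destruct Rcase_abs; lra. }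
  lra.
Qed.

(** The difference [f] is orthogonal to the span. If it were nonzero somewhere, then for [p] in the
    span within [eta] of [f] the integral [I] of [f ^ 2] would equal that of [f * (f - p)] and be at
    most [M * eta], which is below [I] for [eta = I / (2 * (M + 1))]. *)
Lemma coef_unique (g h : R -> R) :
  (forall x, continuous g x) -> (forall x, continuous h x) ->
  g 0 = h 0 -> g 1 = h 1 -> (forall k, coef g k = coef h k) ->
  forall x, 0 <= x <= 1 -> g x = h x.
Proof.
  intros Hg Hh E0 E1 Ek x0 Hx0.
  set (f := fun x => g x - h x).
  assert (Hf : forall x, continuous f x) by (intros x; apply (continuous_minus g h); auto).
  assert (Hk : forall k, coef f k = 0).
  { intros k; unfold f; rewrite coef_minus by assumption; rewrite Ek; ring. }
  destruct (Req_dec (f x0) 0) as [E|E]; [unfold f in E; lra|exfalso].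
  assert (Hpos := RInt_square_pos f x0 Hf Hx0 E); set (I := RInt _ 0 1) in Hpos.
  destruct (continuous_bounded f 0 1) as [M HM]; [lra|assumption|].
  assert (HM0 : 0 <= M) by (apply Rle_trans with (2 := HM 0 ltac:(lra)), Rabs_pos).
  destruct (sine_weierstrass f (I / (2 * (M + 1))) Hf) as [p [Hp Hfp]].
  - unfold f; lra.
  - unfold f; lra.
  - apply Rdiv_lt_0_compat; lra.
  - set (eta := I / (2 * (M + 1))) in *.
    assert (Hz := coef_zero_span f p Hf Hk Hp).
    assert (Hcp := sine_span_continuous p Hp).
    assert (EI : I = RInt (fun x => f x * (f x - p x)) 0 1).
    { unfold I; rewrite (RInt_ext (fun x => f x * (f x - p x)) (fun x => minus (f x * f x) (f x * p x))).
      - rewrite (RInt_minus (V := R_CompleteNormedModule)), Hz.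
        + unfold minus, plus, opp; simpl; rewrite Ropp_0, Rplus_0_r; reflexivity.
        + apply (ex_RInt_continuous (V := R_CompleteNormedModule)); intros x _.
          apply (continuous_mult f f); auto.
        + apply (ex_RInt_continuous (V := R_CompleteNormedModule)); intros x _.
          apply (continuous_mult f p); auto.
      - intros x _; unfold minus, plus, opp; simpl; ring. }
    assert (Hle : Rabs (RInt (fun x => f x * (f x - p x)) 0 1) <= (1 - 0) * (M * eta)).
    { apply abs_RInt_le_const; [lra| |].
      - apply (ex_RInt_continuous (V := R_CompleteNormedModule)); intros x _.
        apply (continuous_mult f (fun x => f x - p x)); auto.
        apply (continuous_minus f p); auto.
      - intros x Hx; rewrite Rabs_mult; apply Rmult_le_compat; auto using Rabs_pos. }
    rewrite <- EI, Rabs_right in Hle by lra.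
    assert (Heq : eta * (2 * (M + 1)) = I) by (unfold eta; field; lra).
    assert (0 < eta) by (apply Rdiv_lt_0_compat; lra); nra.
Qed.

(** * Linear flow *)

Lemma coef_scal (h : R -> R) (c : R) (k : nat) :
  (forall x, continuous h x) -> coef (fun x => c * h x) k = c * coef h k.
Proof.
  intros Hh; rewrite (coef_ext _ (fun x => h x + (c - 1) * h x)) by (intros; ring).
  rewrite coef_linear by assumption; ring.
Qed.

Lemma time_continuous_scal (u : R -> R -> R) (c : R) : time_continuous u -> time_continuous (fun x t => c * u x t).
Proof.
  intros [H1 H2]; split.
  - intros t x; apply (continuous_mult (fun _ => c) (fun y => u y t)); auto.
    apply continuous_const.
  - intros t eps Heps; pose proof (Rabs_pos c) as Hc.
    destruct (H2 t (eps / (Rabs c + 1))) as [d [Hd Hd']]; [apply Rdiv_lt_0_compat; lra|].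
    exists d; split; [assumption|]; intros s Hs x; specialize (Hd' s Hs x).
    replace (c * u x s - c * u x t) with (c * (u x s - u x t)) by ring; rewrite Rabs_mult.
    apply Rle_trans with ((Rabs c + 1) * (eps / (Rabs c + 1))); [|right; field; lra].
    pose proof (Rabs_pos (u x s - u x t)); nra.
Qed.

Lemma time_continuous_cont_rect (u : R -> R -> R) (A B T : R) : time_continuous u -> cont_rect u A B T.
Proof.
  intros [H1 H2] x t _ _ eps Heps.
  destruct (H2 t (eps / 2)) as [d [Hd Hd']]; [lra|].
  destruct (proj1 (continuous_eps _ _) (H1 t x) (eps / 2)) as [d' [Hd1 Hd1']]; [lra|].
  exists (Rmin d d'); split; [now apply Rmin_glb_lt|]; intros y s _ _ Hy Hs.
  specialize (Hd' s (Rlt_le_trans _ _ _ Hs (Rmin_l _ _)) y).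
  specialize (Hd1' y (Rlt_le_trans _ _ _ Hy (Rmin_r _ _))).
  revert Hd' Hd1'; unfold Rabs; repeat destruct Rcase_abs; lra.
Qed.

Lemma unif_cauchy_limit (f : nat -> R -> R -> R) (e : nat -> R) :
  is_lim_seq e 0 -> (forall n m x t, Rabs (f n x t - f m x t) <= e n + e m) ->
  exists w, forall n x t, Rabs (w x t - f n x t) <= e n.
Proof.
  intros He Hf; exists (fun x t => real (Lim_seq (fun n => f n x t))); intros n x t.
  assert (Hc : ex_finite_lim_seq (fun n => f n x t)).
  { apply ex_lim_seq_cauchy_corr; intros eps.
    assert (He' := proj1 (filterlim_locally _ _) He (pos_div_2 eps)).
    destruct He' as [N HN]; exists N; intros i j Hi Hj.
    apply Rle_lt_trans with (1 := Hf i j x t).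
    generalize (HN i Hi) (HN j Hj); unfold ball; simpl; unfold AbsRing_ball, abs, minus, plus, opp; simpl.
    unfold Rabs; repeat destruct Rcase_abs; lra. }
  apply Lim_seq_correct' in Hc.
  assert (Hlim : is_lim_seq (fun m => Rabs (f m x t - f n x t))
    (Rabs (real (Lim_seq (fun n => f n x t)) - f n x t))).
  { apply (is_lim_seq_abs (fun m => f m x t - f n x t)
      (Finite (real (Lim_seq (fun n => f n x t)) - f n x t))).
    apply is_lim_seq_minus'; [assumption|apply is_lim_seq_const]. }
  assert (Hle := is_lim_seq_le _ (fun m => e m + e n) _ (0 + e n) (fun m => Hf m n x t) Hlim).
  rewrite Rplus_0_l in Hle; apply Hle.
  replace (Finite (e n)) with (Finite (0 + e n)) by (f_equal; ring).
  apply is_lim_seq_plus'; [assumption|apply is_lim_seq_const].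
Qed.

(** Eigenvalue of minus the second derivative plus [mu] on the mode [sn k]. *)
Definition kap (mu : R) (k : nat) : R := (INR (S k) * PI) ^ 2 + mu.

Lemma kap_pos (mu : R) (k : nat) : 0 <= mu -> 0 < kap mu k.
Proof.
  intros Hmu; unfold kap; pose proof PI_RGT_0; pose proof (lt_0_INR (S k) ltac:(lia)).
  assert (0 < (INR (S k) * PI) ^ 2) by (apply pow_lt; nra); lra.
Qed.

(** The equation is imposed for all real [x] and [t]: the flow of a finite sum of modes is explicit
    and solves it everywhere. *)
Definition heat_solution (mu : R) (p : R -> R) (W : R -> R -> R) : Prop :=
  time_continuous W /\ (forall x, W x 0 = p x) /\ (forall t, W 0 t = 0 /\ W 1 t = 0) /\
  (forall t k, coef (fun x => W x t) k = exp (- kap mu k * t) * coef p k) /\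
  exists Wt Wx Wxx, forall x t,
    is_derive (fun s => W x s) t (Wt x t) /\ is_derive (fun y => W y t) x (Wx x t) /\
    is_derive (fun y => Wx y t) x (Wxx x t) /\ Wt x t - Wxx x t = - mu * W x t.

Lemma is_derive_linear (f g : R -> R) (c x df dg : R) :
  is_derive f x df -> is_derive g x dg -> is_derive (fun y => f y + c * g y) x (df + c * dg).
Proof.
  intros Hf Hg; apply (is_derive_plus (V := R_NormedModule) f (fun y => c * g y)); [assumption|].
  now apply is_derive_scal.
Qed.

Lemma heat_solution_span (mu : R) (p : R -> R) :
  sine_span p -> exists W, heat_solution mu p W.
Proof.
  induction 1 as [k|f g c Hf [U HU] Hg [V HV]|f g Hf [U HU] Hfg].
  - exists (fun x t => exp (- kap mu k * t) * sn k x); repeat split.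
    + apply (time_continuous_mode (fun t => exp (- kap mu k * t))).
      intros t; apply (ex_derive_continuous (fun t => exp (- kap mu k * t))); auto_derive; auto.
    + apply (time_continuous_mode (fun t => exp (- kap mu k * t))).
      intros t; apply (ex_derive_continuous (fun t => exp (- kap mu k * t))); auto_derive; auto.
    + intros x; rewrite Rmult_0_r, exp_0; ring.
    + rewrite sn_0; ring.
    + rewrite sn_1; ring.
    + intros t j; rewrite coef_scal by apply sn_continuous; rewrite coef_sn.
      destruct (Nat.eqb_spec k j) as [->|_]; ring.
    + set (b := INR (S k) * PI).
      exists (fun x t => - kap mu k * exp (- kap mu k * t) * sn k x),
        (fun x t => exp (- kap mu k * t) * (b * cos (b * x))),
        (fun x t => exp (- kap mu k * t) * (- b * b * sn k x)).
      intros x t; cbv beta; split; [|split; [|split]].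
      * generalize (kap mu k) (sn k x); intros q s; auto_derive; [auto|ring].
      * apply (is_derive_scal (sn k)), sn_derive.
      * unfold sn; fold b; generalize (kap mu k) b; intros q b'; auto_derive; [auto|ring].
      * unfold kap; fold b; ring.
  - destruct HU as [U1 [U2 [U3 [U4 [Ut [Ux [Uxx U5]]]]]]].
    destruct HV as [V1 [V2 [V3 [V4 [Vt [Vx [Vxx V5]]]]]]].
    exists (fun x t => U x t + c * V x t).
    split; [|split; [|split; [|split]]].
    + apply time_continuous_plus; [assumption|now apply time_continuous_scal].
    + intros x; now rewrite U2, V2.
    + intros t; destruct (U3 t) as [-> ->]; destruct (V3 t) as [-> ->]; lra.
    + intros t k; rewrite (coef_linear (fun x => U x t) (fun x => V x t)) by (apply U1 || apply V1).
      rewrite (coef_linear f g) by now apply sine_span_continuous.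
      rewrite U4, V4; ring.
    + exists (fun x t => Ut x t + c * Vt x t), (fun x t => Ux x t + c * Vx x t),
        (fun x t => Uxx x t + c * Vxx x t); intros x t.
      destruct (U5 x t) as [Ua [Ub [Uc Ud]]]; destruct (V5 x t) as [Va [Vb [Vc Vd]]].
      split; [|split; [|split]]; try now apply is_derive_linear.
      nra.
  - destruct HU as [U1 [U2 [U3 [U4 U5]]]]; exists U; repeat split; try apply U1; try apply U3.
    + intros x; now rewrite U2.
    + intros t k; rewrite U4; f_equal; apply coef_ext; auto.
    + exact U5.
Qed.

Lemma heat_solution_zero (mu : R) : heat_solution mu (fun _ => 0) (fun _ _ => 0).
Proof.
  assert (HC : time_continuous (fun _ _ => 0)).
  { split; [intros; apply continuous_const|]; intros t eps Heps; exists 1; split; [lra|].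
    intros; rewrite Rminus_diag, Rabs_R0; lra. }
  split; [assumption|]; repeat split.
  - intros t k.
    assert (E : coef (fun _ => 0) k = 0).
    { rewrite (coef_ext _ (fun x => 0 * sn k x)) by (intros; ring).
      rewrite coef_scal by apply sn_continuous; ring. }
    rewrite E; ring.
  - exists (fun _ _ => 0), (fun _ _ => 0), (fun _ _ => 0); intros x t.
    split; [|split; [|split]]; try apply (is_derive_const (V := R_NormedModule)); ring.
Qed.

(** Maximum principle for [W - W' - d]: where it is positive, [W - W'] exceeds [d >= 0], so the
    right-hand side [- mu * (W - W')] is nonpositive. Exchanging [W] and [W'] gives the other
    inequality. *)
Lemma heat_solution_contract (mu : R) (p q : R -> R) (W W' : R -> R -> R) (d : R) :
  0 <= mu -> heat_solution mu p W -> heat_solution mu q W' ->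
  (forall x, 0 <= x <= 1 -> Rabs (p x - q x) <= d) ->
  forall x t, 0 <= x <= 1 -> 0 <= t -> Rabs (W x t - W' x t) <= d.
Proof.
  intros Hmu.
  assert (Hw : forall p q W W', heat_solution mu p W -> heat_solution mu q W' ->
    (forall x, 0 <= x <= 1 -> Rabs (p x - q x) <= d) ->
    forall x t, 0 <= x <= 1 -> 0 <= t -> W x t - W' x t <= d).
  { clear p q W W'; intros p q U V [U1 [U2 [U3 [_ [Ut [Ux [Uxx U5]]]]]]]
      [V1 [V2 [V3 [_ [Vt [Vx [Vxx V5]]]]]]] Hpq x t Hx Ht.
    assert (Hd : 0 <= d) by (apply Rle_trans with (2 := Hpq 0 ltac:(lra)), Rabs_pos).
    cut (U x t + (-1) * V x t - d <= 0); [lra|].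
    apply (max_principle (fun x t => U x t + (-1) * V x t - d)
      (fun x t => Ut x t + (-1) * Vt x t) (fun x t => Ux x t + (-1) * Vx x t)
      (fun x t => Uxx x t + (-1) * Vxx x t) 0 1 (t + 1) 0); try lra.
    - intros y s Hy Hs eps Heps.
      destruct (time_continuous_cont_rect _ 0 1 (t + 1) (time_continuous_plus _ _ U1 (time_continuous_scal _ (-1) V1)) y s Hy Hs eps Heps)
        as [e [He He']].
      exists e; split; [assumption|]; intros y' s' Hy' Hs' H1 H2.
      specialize (He' y' s' Hy' Hs' H1 H2).
      match goal with |- Rabs ?a < _ => match type of He' with Rabs ?b < _ =>
        replace a with b by ring end end; assumption.
    - intros y s _ _; destruct (U5 y s) as [Ua [Ub [Uc _]]]; destruct (V5 y s) as [Va [Vb [Vc _]]].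
      assert (Hsub : forall (f : R -> R) z l, is_derive f z l -> is_derive (fun r => f r - d) z l).
      { intros f z l Hf; replace l with (minus l 0) by (unfold minus, plus, opp; simpl; ring).
        apply (is_derive_minus (V := R_NormedModule) f (fun _ => d)); [assumption|].
        apply (is_derive_const (V := R_NormedModule)). }
      split; [|split].
      + apply Hsub, is_derive_linear; assumption.
      + apply Hsub, is_derive_linear; assumption.
      + now apply is_derive_linear.
    - intros y s _ _ Hpos; destruct (U5 y s) as [_ [_ [_ Ud]]]; destruct (V5 y s) as [_ [_ [_ Vd]]].
      nra.
    - intros y Hy; rewrite U2, V2; specialize (Hpq y Hy).
      revert Hpq; unfold Rabs; destruct Rcase_abs; lra.
    - intros s Hs; destruct (U3 s) as [-> ->]; destruct (V3 s) as [-> ->]; lra. }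
  intros HW HW' Hpq x t Hx Ht; apply Rabs_le; split.
  - cut (W' x t - W x t <= d); [lra|]; apply (Hw q p); try assumption.
    intros y Hy; rewrite Rabs_minus_sym; auto.
  - now apply (Hw p q).
Qed.

Lemma half_pow_lim (C : R) : is_lim_seq (fun n => C * (/ 2) ^ n) 0.
Proof.
  replace (Finite 0) with (Rbar_mult C 0) by (simpl; f_equal; ring).
  apply is_lim_seq_scal_l, is_lim_seq_geom; rewrite Rabs_right; lra.
Qed.

(** Sine polynomials within [(/ 2) ^ n] of [u0] have explicit flows, and the sup norm contraction
    makes these flows uniformly Cauchy down to [t = 0]. All the stated properties pass to the
    limit. *)
Lemma linear_flow (mu : R) (u0 : R -> R) :
  0 <= mu -> (forall x, continuous u0 x) -> u0 0 = 0 -> u0 1 = 0 ->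
  exists w, time_continuous w /\ (forall x, 0 <= x <= 1 -> w x 0 = u0 x) /\
    (forall t, w 0 t = 0 /\ w 1 t = 0) /\
    (forall t k, 0 <= t -> coef (fun x => w x t) k = exp (- kap mu k * t) * coef u0 k) /\
    exists M, forall x t, Rabs (w x t) <= M.
Proof.
  intros Hmu Hu0 E0 E1.
  assert (Hpow : forall n, 0 < 1 * (/ 2) ^ n) by (intros n; rewrite Rmult_1_l; apply pow_lt; lra).
  assert (Hex : forall n, exists pW : (R -> R) * (R -> R -> R),
    (forall x, continuous (fst pW) x) /\
    heat_solution mu (fst pW) (snd pW) /\
    forall x, 0 <= x <= 1 -> Rabs (u0 x - fst pW x) <= 1 * (/ 2) ^ n).
  { intros n; destruct (sine_weierstrass u0 (1 * (/ 2) ^ n)) as [p [Hp Hup]]; auto.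
    destruct (heat_solution_span mu p Hp) as [W HW]; exists (p, W).
    split; [now apply sine_span_continuous|auto]. }
  pose (P := fun n => proj1_sig (constructive_indefinite_description _ (Hex n))).
  assert (HP : forall n, (forall x, continuous (fst (P n)) x) /\
    heat_solution mu (fst (P n)) (snd (P n)) /\
    forall x, 0 <= x <= 1 -> Rabs (u0 x - fst (P n) x) <= 1 * (/ 2) ^ n)
    by (intros n; exact (proj2_sig (constructive_indefinite_description _ (Hex n)))).
  clearbody P.
  (* Freezing the arguments outside [[0, 1]] and below time [0] turns estimates on the half strip
     into estimates on the whole plane. *)
  set (f := fun n x t => snd (P n) (clamp 0 1 x) (Rmax 0 t)).
  destruct (unif_cauchy_limit f (fun n => 1 * (/ 2) ^ n) (half_pow_lim 1)) as [w Hw].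
  { intros n m x t; unfold f; destruct (HP n) as [_ [Hn Hn']]; destruct (HP m) as [_ [Hm Hm']].
    apply (heat_solution_contract mu _ _ _ _ _ Hmu Hn Hm).
    - intros y Hy; generalize (Hn' y Hy) (Hm' y Hy); unfold Rabs; repeat destruct Rcase_abs; lra.
    - apply clamp_bounds; lra.
    - apply Rmax_l. }
  assert (Hsq : forall a b C, (forall n, Rabs (a - b) <= C * (/ 2) ^ n) -> a = b).
  { intros a b C H; apply Rminus_diag_uniq, Rabs_eq_0, Rle_antisym; [|apply Rabs_pos].
    exact (is_lim_seq_le (fun _ => Rabs (a - b)) _ (Rabs (a - b)) 0 H (is_lim_seq_const _)
      (half_pow_lim C)). }
  assert (Hf : forall n, time_continuous (f n)).
  { intros n; apply (time_continuous_comp (snd (P n)) (clamp 0 1) (Rmax 0)); [apply HP| |].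
    - apply (lipschitz_continuous _ 1); intros a b; rewrite Rmult_1_l; apply clamp_lipschitz.
    - apply (lipschitz_continuous _ 1); intros a b; rewrite Rmult_1_l; apply Rmax0_lipschitz. }
  assert (HCC : time_continuous w).
  { apply time_continuous_unif_limit; intros eps Heps.
    assert (Hl := proj1 (filterlim_locally _ _) (half_pow_lim 1) (mkposreal eps Heps)).
    destruct Hl as [N HN]; specialize (HN N (Nat.le_refl N)).
    exists (f N); split; [apply Hf|]; intros x t.
    apply Rle_trans with (1 := Hw N x t).
    revert HN; unfold ball; simpl; unfold AbsRing_ball, abs, minus, plus, opp; simpl.
    unfold Rabs; destruct Rcase_abs; lra. }
  exists w; split; [assumption|]; split; [|split; [|split]].
  - intros x Hx; apply (Hsq _ _ 2); intros n.
    assert (H1 := Hw n x 0); unfold f in H1; rewrite clamp_id, Rmax_left in H1 by lra.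
    destruct (HP n) as [_ [[_ [Hi _]] Hn']]; rewrite Hi in H1; specialize (Hn' x Hx).
    revert H1 Hn'; unfold Rabs; repeat destruct Rcase_abs; lra.
  - intros t; split; apply (Hsq _ _ 1); intros n.
    + assert (H1 := Hw n 0 t); unfold f in H1; rewrite clamp_id in H1 by lra.
      destruct (HP n) as [_ [[_ [_ [Hb _]]] _]]; destruct (Hb (Rmax 0 t)) as [Hb0 _].
      now rewrite Hb0 in H1.
    + assert (H1 := Hw n 1 t); unfold f in H1; rewrite clamp_id in H1 by lra.
      destruct (HP n) as [_ [[_ [_ [Hb _]]] _]]; destruct (Hb (Rmax 0 t)) as [_ Hb1].
      now rewrite Hb1 in H1.
  - intros t k Ht; apply (Hsq _ _ 4); intros n.
    destruct (HP n) as [Hc [Hh Hn']].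
    assert (H1 : Rabs (coef (fun x => w x t) k - coef (fun x => f n x t) k) <= 2 * (1 * (/ 2) ^ n)).
    { apply coef_dist; [apply HCC|apply Hf|]; intros; apply Hw. }
    assert (H2 : Rabs (coef u0 k - coef (fst (P n)) k) <= 2 * (1 * (/ 2) ^ n))
      by (apply coef_dist; auto).
    assert (E : coef (fun x => f n x t) k = exp (- kap mu k * t) * coef (fst (P n)) k).
    { rewrite (coef_ext _ (fun x => snd (P n) x t)); [apply Hh|].
      intros x Hx; unfold f; now rewrite clamp_id, Rmax_right by lra. }
    rewrite E in H1; set (q := exp _) in *.
    assert (Hq : 0 < q <= 1).
    { split; [apply exp_pos|]; rewrite <- exp_0.
      unfold q; destruct (Req_dec t 0) as [->|Hne]; [rewrite Rmult_0_r; lra|].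
      left; apply exp_increasing; pose proof (kap_pos mu k Hmu); nra. }
    replace (coef (fun x => w x t) k - q * coef u0 k) with
      ((coef (fun x => w x t) k - q * coef (fst (P n)) k) - q * (coef u0 k - coef (fst (P n)) k)) by ring.
    apply Rle_trans with (1 := Rabs_triang _ _); rewrite Rabs_Ropp, Rabs_mult, (Rabs_right q) by lra.
    pose proof (Rabs_pos (coef u0 k - coef (fst (P n)) k)); nra.
  - destruct (continuous_bounded u0 0 1) as [M HM]; [lra|assumption|].
    exists (M + 3); intros x t.
    set (x' := clamp 0 1 x); assert (Hx' : 0 <= x' <= 1) by (apply clamp_bounds; lra).
    assert (H0 : Rabs (f 0%nat x t - 0) <= M + 1).
    { unfold f; fold x'; destruct (HP 0%nat) as [_ [Hh Hn']].
      apply (heat_solution_contract mu _ _ _ _ _ Hmu Hh (heat_solution_zero mu));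
        [|assumption|apply Rmax_l].
      intros y Hy; specialize (Hn' y Hy); specialize (HM y Hy); simpl in Hn'.
      revert Hn' HM; unfold Rabs; repeat destruct Rcase_abs; lra. }
    assert (H1 := Hw 0%nat x t); simpl in H1.
    revert H0 H1; unfold Rabs; repeat destruct Rcase_abs; lra.
Qed.

(** * Mild solutions of the semilinear problem *)

(** With the integrating factor [exp (kp * (s - s0))] the function becomes nonincreasing. *)
Lemma ode_decay (q q' : R -> R) (kp s0 t : R) :
  s0 <= t -> (forall s, s0 <= s <= t -> is_derive q s (q' s)) ->
  (forall s, s0 <= s <= t -> q' s + kp * q s <= 0) ->
  q t <= exp (- kp * (t - s0)) * q s0.
Proof.
  intros Hst Hq Hle.
  destruct (Req_dec s0 t) as [->|Hne].
  { rewrite Rminus_diag, Rmult_0_r, exp_0; lra. }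
  destruct (MVT_cor2 (fun s => exp (kp * (s - s0)) * q s)
    (fun s => exp (kp * (s - s0)) * (q' s + kp * q s)) s0 t) as [c [Hc Hc']]; [lra| |].
  - intros s Hs; apply is_derive_Reals.
    assert (De : is_derive (fun s => exp (kp * (s - s0))) s (kp * exp (kp * (s - s0))))
      by (auto_derive; [auto|unfold Rminus; ring]).
    assert (Dm := is_derive_mult _ _ _ _ _ De (Hq s Hs) Rmult_comm).
    replace (exp (kp * (s - s0)) * (q' s + kp * q s)) with
      (plus (mult (kp * exp (kp * (s - s0))) (q s)) (mult (exp (kp * (s - s0))) (q' s)));
      [exact Dm|unfold plus, mult; simpl; ring].
  - rewrite Rminus_diag, Rmult_0_r, exp_0 in Hc.
    assert (Hneg := Hle c ltac:(lra)); assert (He := exp_pos (kp * (c - s0))).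
    assert (H1 : exp (kp * (t - s0)) * q t <= q s0).
    { cut (exp (kp * (c - s0)) * (q' c + kp * q c) * (t - s0) <= 0); [lra|].
      rewrite Rmult_assoc; assert ((q' c + kp * q c) * (t - s0) <= 0) by nra; nra. }
    apply Rmult_le_reg_l with (exp (kp * (t - s0))); [apply exp_pos|].
    rewrite <- Rmult_assoc, <- exp_plus.
    replace (kp * (t - s0) + - kp * (t - s0)) with 0 by ring; rewrite exp_0; lra.
Qed.

(** The constant [G / kp] is a supersolution of the scalar equation, so [ode_decay] applies to
    [y - G / kp] and to [- y - G / kp]. *)
Lemma ode_bound (y g : R -> R) (kp s0 t G : R) :
  0 < kp -> s0 <= t -> (forall s, s0 <= s <= t -> is_derive y s (- kp * y s + g s)) ->
  (forall s, s0 <= s <= t -> Rabs (g s) <= G) ->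
  Rabs (y t) <= exp (- kp * (t - s0)) * Rabs (y s0) + G / kp.
Proof.
  intros Hkp Hst Hy Hg.
  assert (HG : 0 <= G / kp).
  { apply Rdiv_le_0_compat; [|assumption].
    apply Rle_trans with (2 := Hg t ltac:(lra)), Rabs_pos. }
  assert (He := exp_pos (- kp * (t - s0))).
  assert (Hw : forall sg, sg = 1 \/ sg = -1 ->
    sg * y t <= exp (- kp * (t - s0)) * Rabs (y s0) + G / kp).
  { intros sg Hsg.
    assert (H := ode_decay (fun s => sg * y s - G / kp) (fun s => sg * (- kp * y s + g s)) kp s0 t Hst).
    cut (sg * y t - G / kp <= exp (- kp * (t - s0)) * (sg * y s0 - G / kp)).
    - assert (sg * y s0 <= Rabs (y s0))
        by (unfold Rabs; destruct Rcase_abs; destruct Hsg as [-> | ->]; lra).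
      nra.
    - apply H.
      + intros s Hs; assert (D := is_derive_scal y s sg _ (Hy s Hs)).
        replace (sg * _) with (minus (sg * (- kp * y s + g s)) 0)
          by (unfold minus, plus, opp; simpl; ring).
        apply (is_derive_minus (V := R_NormedModule) (fun s => sg * y s) (fun _ => G / kp));
          [assumption|apply (is_derive_const (V := R_NormedModule))].
      + intros s Hs; specialize (Hg s Hs).
        replace (sg * (- kp * y s + g s) + kp * (sg * y s - G / kp)) with (sg * g s - G) by (field; lra).
        revert Hg; unfold Rabs; destruct Rcase_abs; destruct Hsg as [-> | ->]; lra. }
  generalize (Hw 1 ltac:(auto)) (Hw (-1) ltac:(auto)); unfold Rabs at 3; destruct Rcase_abs; lra.
Qed.

(** The convolution of [f] with [exp (- kp * t)], factored so that [t] occurs in the integral only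
    as its upper limit; the derivative is then a product rule. *)
Definition duhamel (kp : R) (f : R -> R) (t : R) : R :=
  exp (- kp * t) * RInt (fun s => exp (kp * s) * f s) 0 t.

Lemma duhamel_0 (kp : R) (f : R -> R) : duhamel kp f 0 = 0.
Proof. unfold duhamel; rewrite RInt_point; apply Rmult_0_r. Qed.

Lemma duhamel_derive (kp : R) (f : R -> R) (t : R) :
  (forall s, continuous f s) -> is_derive (duhamel kp f) t (- kp * duhamel kp f t + f t).
Proof.
  intros Hf; unfold duhamel.
  assert (Hc : forall s, continuous (fun s => exp (kp * s) * f s) s).
  { intros s; apply (continuous_mult (fun s => exp (kp * s)) f); [|apply Hf].
    apply (ex_derive_continuous (fun s => exp (kp * s))); auto_derive; auto. }
  assert (De : is_derive (fun s => exp (- kp * s)) t (- kp * exp (- kp * t)))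
    by (auto_derive; [auto|ring]).
  assert (Di : is_derive (fun b => RInt (fun s => exp (kp * s) * f s) 0 b) t (exp (kp * t) * f t)).
  { apply (is_derive_RInt (V := R_NormedModule) (fun s => exp (kp * s) * f s)
      (fun b => RInt (fun s => exp (kp * s) * f s) 0 b) 0 t); [|apply Hc].
    exists (mkposreal 1 Rlt_0_1); intros b _.
    apply (RInt_correct (V := R_CompleteNormedModule)).
    apply (ex_RInt_continuous (V := R_CompleteNormedModule)); intros; apply Hc. }
  assert (Dm := is_derive_mult _ _ _ _ _ De Di Rmult_comm).
  match type of Dm with is_derive _ _ ?l => match goal with |- is_derive _ _ ?r =>
    replace r with l; [exact Dm|] end end.
  unfold plus, mult; simpl.
  assert (E : exp (- kp * t) * exp (kp * t) = 1)
    by (rewrite <- exp_plus, <- exp_0; f_equal; ring).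
  replace (exp (- kp * t) * (exp (kp * t) * f t)) with (exp (- kp * t) * exp (kp * t) * f t) by ring.
  rewrite E; ring.
Qed.

Lemma duhamel_dist (kp : R) (f g : R -> R) (t d : R) :
  0 < kp -> 0 <= t -> (forall s, continuous f s) -> (forall s, continuous g s) ->
  (forall s, Rabs (f s - g s) <= d) -> Rabs (duhamel kp f t - duhamel kp g t) <= d / kp.
Proof.
  intros Hkp Ht Hf Hg Hd.
  assert (H := ode_bound (fun s => duhamel kp f s - duhamel kp g s) (fun s => f s - g s) kp 0 t d Hkp Ht).
  cbv beta in H; rewrite !duhamel_0, (Rminus_diag 0), Rabs_R0, Rmult_0_r, Rplus_0_l in H.
  apply H; [|auto]; intros s _.
  replace (- kp * _ + _) with
    (minus (- kp * duhamel kp f s + f s) (- kp * duhamel kp g s + g s))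
    by (unfold minus, plus, opp; simpl; ring).
  apply (is_derive_minus (V := R_NormedModule) (duhamel kp f) (duhamel kp g)); now apply duhamel_derive.
Qed.

Lemma duhamel_bound (kp : R) (f : R -> R) (t B : R) :
  0 < kp -> 0 <= t -> (forall s, continuous f s) -> (forall s, Rabs (f s) <= B) ->
  Rabs (duhamel kp f t) <= B / kp.
Proof.
  intros Hkp Ht Hf HB.
  assert (H := ode_bound (duhamel kp f) f kp 0 t B Hkp Ht).
  rewrite duhamel_0, Rabs_R0, Rmult_0_r, Rplus_0_l in H.
  apply H; [|auto]; intros s _; now apply duhamel_derive.
Qed.

Lemma time_continuous_fixed_point (Phi : (R -> R -> R) -> R -> R -> R) (w : R -> R -> R) (C : R) :
  time_continuous w -> (forall u, time_continuous u -> time_continuous (Phi u)) ->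
  (forall u v d, time_continuous u -> time_continuous v -> (forall x t, Rabs (u x t - v x t) <= d) ->
     forall x t, Rabs (Phi u x t - Phi v x t) <= d / 2) ->
  (forall x t, Rabs (Phi w x t - w x t) <= C) ->
  exists u, time_continuous u /\ forall x t, u x t = Phi u x t.
Proof.
  intros Hw HP Hc H0.
  set (U := fun n => Nat.iter n Phi w).
  assert (HU : forall n, time_continuous (U n)) by (induction n; [exact Hw|apply HP, IHn]).
  assert (HC : 0 <= C) by (apply Rle_trans with (2 := H0 0 0), Rabs_pos).
  assert (H1 : forall n x t, Rabs (U (S n) x t - U n x t) <= C * (/ 2) ^ n).
  { induction n as [|n IH]; intros x t; [rewrite pow_O, Rmult_1_r; apply H0|].
    replace (C * (/ 2) ^ S n) with (C * (/ 2) ^ n / 2) by (simpl; field).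
    exact (Hc (U (S n)) (U n) _ (HU (S n)) (HU n) IH x t). }
  (* The exact geometric sum is kept, since the weaker bound [2 * C * (/ 2) ^ n] would not close the
     induction on [p]. *)
  assert (H2 : forall p n x t, Rabs (U (n + p)%nat x t - U n x t) <= 2 * C * ((/ 2) ^ n - (/ 2) ^ (n + p))).
  { induction p as [|p IH]; intros n x t.
    - rewrite Nat.add_0_r, !Rminus_diag, Rabs_R0; lra.
    - rewrite Nat.add_succ_r; specialize (IH n x t); assert (H := H1 (n + p)%nat x t).
      replace ((/ 2) ^ S (n + p)) with ((/ 2) ^ (n + p) / 2) by (simpl; field).
      replace (U (S (n + p)) x t - U n x t) with
        ((U (S (n + p)) x t - U (n + p)%nat x t) + (U (n + p)%nat x t - U n x t)) by ring.
      apply Rle_trans with (1 := Rabs_triang _ _); lra. }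
  assert (Hpow : forall n, 0 < (/ 2) ^ n) by (intros n; apply pow_lt; lra).
  destruct (unif_cauchy_limit U (fun n => 2 * C * (/ 2) ^ n) (half_pow_lim (2 * C))) as [u Hu].
  { assert (Hw' : forall n m x t, (n <= m)%nat -> Rabs (U m x t - U n x t) <= 2 * C * (/ 2) ^ n).
    { intros n m x t Hnm; replace m with (n + (m - n))%nat by lia.
      apply Rle_trans with (1 := H2 _ _ _ _).
      apply Rmult_le_compat_l; [lra|]; pose proof (Hpow (n + (m - n))%nat); lra. }
    intros n m x t.
    assert (0 <= 2 * C * (/ 2) ^ n) by (apply Rmult_le_pos; [lra|apply Rlt_le, Hpow]).
    assert (0 <= 2 * C * (/ 2) ^ m) by (apply Rmult_le_pos; [lra|apply Rlt_le, Hpow]).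
    destruct (Nat.le_ge_cases n m) as [Hnm|Hnm].
    - rewrite Rabs_minus_sym; specialize (Hw' n m x t Hnm); lra.
    - specialize (Hw' m n x t Hnm); lra. }
  assert (HCu : time_continuous u).
  { apply time_continuous_unif_limit; intros eps Heps.
    assert (Hl := proj1 (filterlim_locally _ _) (half_pow_lim (2 * C)) (mkposreal eps Heps)).
    destruct Hl as [N HN]; specialize (HN N (Nat.le_refl N)).
    exists (U N); split; [apply HU|]; intros x t.
    apply Rle_trans with (1 := Hu N x t).
    revert HN; unfold ball; simpl; unfold AbsRing_ball, abs, minus, plus, opp; simpl.
    unfold Rabs; destruct Rcase_abs; lra. }
  exists u; split; [assumption|]; intros x t.
  apply Rminus_diag_uniq, Rabs_eq_0, Rle_antisym; [|apply Rabs_pos].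
  apply (is_lim_seq_le (fun _ => Rabs (u x t - Phi u x t)) (fun n => 2 * C * (/ 2) ^ n)
    (Rabs (u x t - Phi u x t)) 0); [|apply is_lim_seq_const|apply half_pow_lim].
  intros n.
  assert (Ha := Hu (S n) x t).
  assert (Hb := Hc u (U n) _ HCu (HU n) (Hu n) x t).
  change (Phi (U n) x t) with (U (S n) x t) in Hb.
  replace ((/ 2) ^ S n) with ((/ 2) ^ n / 2) in Ha by (simpl; field).
  revert Ha Hb; unfold Rabs; repeat destruct Rcase_abs; lra.
Qed.

(** Comparison with the telescoping series of [2 / ((k + m) * (k + 1 + m))], whose sum is [2 / m].
    It dominates because [(k + 1 + m) ^ 2 / 2 <= (k + 1) ^ 2 + m ^ 2] and [PI >= 1]. *)
Lemma inv_kap_series (m : R) : 0 < m ->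
  ex_series (fun k => / kap (m ^ 2) k) /\ Series (fun k => / kap (m ^ 2) k) <= 2 / m.
Proof.
  intros Hm.
  set (b := fun k => 2 * (/ (INR k + m) - / (INR (S k) + m))).
  assert (Hb : is_series b (2 / m)).
  { assert (Es : forall n, sum_n b n = 2 * (/ m - / (INR (S n) + m))).
    { induction n as [|n IH].
      - rewrite sum_O; unfold b; simpl (INR 0); now rewrite Rplus_0_l.
      - rewrite sum_Sn, IH; unfold b, plus; simpl plus; cbv beta; simpl; ring. }
    assert (Hl : is_lim_seq (sum_n b) (2 * (/ m - 0))).
    { apply (is_lim_seq_ext (fun n => 2 * (/ m - / (INR (S n) + m)))); [intros; now rewrite Es|].
      apply (is_lim_seq_scal_l _ 2 (Finite (/ m - 0))).
      apply is_lim_seq_minus'; [apply is_lim_seq_const|].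
      replace (Finite 0) with (Rbar_inv p_infty) by reflexivity.
      apply is_lim_seq_inv; [|discriminate].
      apply (is_lim_seq_le_p_loc INR).
      - exists 0%nat; intros n _; rewrite S_INR; lra.
      - apply is_lim_seq_INR. }
    replace (2 / m) with (2 * (/ m - 0)) by (field; lra); exact Hl. }
  assert (Hk : forall k, 0 <= / kap (m ^ 2) k <= b k).
  { intros k; assert (Hkp := kap_pos (m ^ 2) k (pow2_ge_0 m)); split.
    - now apply Rlt_le, Rinv_0_lt_compat.
    - unfold b; rewrite S_INR; assert (Hk0 := pos_INR k).
      replace (2 * (/ (INR k + m) - / (INR k + 1 + m))) with (/ ((INR k + m) * (INR k + 1 + m) / 2))
        by (field; lra).
      apply Rinv_le_contravar; [nra|].
      unfold kap; rewrite S_INR; assert (HP : 1 <= PI) by (pose proof PI2_1; lra).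
      assert ((INR k + 1) ^ 2 <= ((INR k + 1) * PI) ^ 2) by (apply pow_incr; nra).
      assert ((INR k + m) * (INR k + 1 + m) / 2 <= (INR k + 1 + m) ^ 2 / 2) by nra.
      assert ((INR k + 1 + m) ^ 2 / 2 <= (INR k + 1) ^ 2 + m ^ 2)
        by (pose proof (pow2_ge_0 (INR k + 1 - m)); nra).
      lra. }
  split.
  - apply (ex_series_le (V := R_CompleteNormedModule) _ b); [|now exists (2 / m)].
    intros k; change (Rabs (/ kap (m ^ 2) k) <= b k); rewrite Rabs_right; [apply Hk|].
    apply Rle_ge, Hk.
  - rewrite <- (is_series_unique _ _ Hb); apply Series_le; [apply Hk|now exists (2 / m)].
Qed.

(** Bounds for all real arguments spare any control on the size of the Picard iterates; truncating
    the quadratic term provides them. *)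
Definition bounded_lipschitz (F : R -> R -> R) (B L : R) : Prop :=
  (forall v x, continuous (fun y => F y v) x) /\ (forall x v, Rabs (F x v) <= B) /\
  0 <= L /\ (forall x v w, Rabs (F x v - F x w) <= L * Rabs (v - w)).

Lemma time_continuous_nonlinear (F u : R -> R -> R) (B L : R) :
  bounded_lipschitz F B L -> time_continuous u -> time_continuous (fun x t => F x (u x t)).
Proof.
  intros [HFc [_ [HL HFl]]] [H1 H2]; split.
  - intros t x; apply continuous_eps; intros eps Heps.
    destruct (proj1 (continuous_eps _ _) (H1 t x) (eps / 2 / (L + 1))) as [d [Hd Hd']];
      [apply Rdiv_lt_0_compat; lra|].
    destruct (proj1 (continuous_eps _ _) (HFc (u x t) x) (eps / 2)) as [e [He He']]; [lra|].
    exists (Rmin d e); split; [now apply Rmin_glb_lt|]; intros y Hy.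
    specialize (Hd' y (Rlt_le_trans _ _ _ Hy (Rmin_l _ _))).
    specialize (He' y (Rlt_le_trans _ _ _ Hy (Rmin_r _ _))).
    replace (F y (u y t) - F x (u x t)) with
      ((F y (u y t) - F y (u x t)) + (F y (u x t) - F x (u x t))) by ring.
    apply Rle_lt_trans with (1 := Rabs_triang _ _).
    assert (Hl := HFl y (u y t) (u x t)); pose proof (Rabs_pos (u y t - u x t)).
    assert (E : (L + 1) * (eps / 2 / (L + 1)) = eps / 2) by (field; lra); nra.
  - intros t eps Heps.
    destruct (H2 t (eps / (L + 1))) as [d [Hd Hd']]; [apply Rdiv_lt_0_compat; lra|].
    exists d; split; [assumption|]; intros s Hs x; specialize (Hd' s Hs x).
    assert (Hl := HFl x (u x s) (u x t)); pose proof (Rabs_pos (u x s - u x t)).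
    assert (E : (L + 1) * (eps / (L + 1)) = eps) by (field; lra); nra.
Qed.

(** If two functions differ by at most [d], the coefficients of the forcing differ by at most
    [2 * L * d], their Duhamel terms by that over [kap], and the sum over modes is at most
    [4 * L * d / m]. The condition [8 * L <= m] makes this [d / 2]. *)
Lemma mild_solution (F : R -> R -> R) (B L m : R) (u0 : R -> R) :
  bounded_lipschitz F B L -> 0 < m -> 8 * L <= m ->
  (forall x, continuous u0 x) -> u0 0 = 0 -> u0 1 = 0 ->
  exists u, time_continuous u /\ (exists M, forall x t, Rabs (u x t) <= M) /\
    (forall x, 0 <= x <= 1 -> u x 0 = u0 x) /\
    (forall t, u 0 t = 0 /\ u 1 t = 0) /\
    (forall k t, 0 < t -> is_derive (fun s => coef (fun x => u x s) k) t
       (- kap (m ^ 2) k * coef (fun x => u x t) k + coef (fun x => F x (u x t)) k)).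
Proof.
  intros HF Hm HLm Hu0 E0 E1.
  assert (Hmu := pow2_ge_0 m).
  destruct (linear_flow (m ^ 2) u0 Hmu Hu0 E0 E1) as [w [Hw [Hw0 [Hwb [Hwc [Mw HMw]]]]]].
  destruct (inv_kap_series m Hm) as [Hex HE]; set (kp := kap (m ^ 2)) in *.
  assert (Hkp : forall k, 0 < kp k) by (intros k; now apply kap_pos).
  destruct HF as [HFc [HFb [HL HFl]]].
  assert (HF : bounded_lipschitz F B L) by (repeat split; assumption).
  assert (HB : 0 <= B) by (apply Rle_trans with (2 := HFb 0 0), Rabs_pos).
  set (fk := fun (u : R -> R -> R) k s => coef (fun x => F x (u x s)) k).
  assert (Hfk : forall u k s, time_continuous u -> continuous (fk u k) s).
  { intros u k s Hu; apply (coef_time_continuous (fun x t => F x (u x t))); now apply time_continuous_nonlinear with B L. }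
  assert (Hfb : forall u k s, time_continuous u -> Rabs (fk u k s) <= 2 * B).
  { intros u k s Hu; apply coef_bound; [apply (time_continuous_nonlinear F u B L HF Hu)|intros; apply HFb]. }
  (* For negative times the Duhamel term is frozen at its value [0], so that continuity and bounds
     hold for every real [t]. *)
  set (c := fun u k t => duhamel (kp k) (fk u k) (Rmax 0 t)).
  assert (Hcc : forall u k t, time_continuous u -> continuous (c u k) t).
  { intros u k t Hu; apply (continuous_comp (Rmax 0) (duhamel (kp k) (fk u k))).
    - apply (lipschitz_continuous _ 1); intros a b; rewrite Rmult_1_l; apply Rmax0_lipschitz.
    - apply (ex_derive_continuous (duhamel (kp k) (fk u k))); eexists; apply duhamel_derive; auto. }
  assert (Hcb : forall u k t, time_continuous u -> Rabs (c u k t) <= 2 * B * / kp k).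
  { intros u k t Hu; apply duhamel_bound; auto; apply Rmax_l. }
  assert (HexB : forall b, ex_series (fun k => b * / kp k))
    by (intros b; exact (ex_series_scal_l (K := R_AbsRing) b _ Hex)).
  set (Phi := fun u x t => w x t + sine_series (fun k => c u k t) x).
  assert (HPb : forall u x t, time_continuous u -> Rabs (sine_series (fun k => c u k t) x) <= 2 * B * (2 / m)).
  { intros u x t Hu; apply Rle_trans with (Series (fun k => 2 * B * / kp k)).
    - apply sine_series_bound; auto.
    - rewrite Series_scal_l; apply Rmult_le_compat_l; lra. }
  destruct (time_continuous_fixed_point Phi w (2 * B * (2 / m)) Hw) as [u [Hu Hfix]].
  - intros u Hu; apply time_continuous_plus; [assumption|].
    apply (time_continuous_sine_series (c u) (fun k => 2 * B * / kp k)); auto.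
  - intros u v d Hu Hv Hd x t; unfold Phi.
    assert (Hd0 : 0 <= d) by (apply Rle_trans with (2 := Hd 0 0), Rabs_pos).
    replace (_ - _) with (sine_series (fun k => c u k t) x - sine_series (fun k => c v k t) x) by ring.
    rewrite (sine_series_minus _ _ (fun k => 2 * B * / kp k) (fun k => 2 * B * / kp k)) by auto.
    apply Rle_trans with (Series (fun k => 2 * (L * d) * / kp k)).
    + apply sine_series_bound; [|apply HexB]; intros k; apply duhamel_dist; auto; [apply Rmax_l|].
      intros s; apply coef_dist; [apply (time_continuous_nonlinear F u B L HF Hu)|apply (time_continuous_nonlinear F v B L HF Hv)|].
      intros y _; apply Rle_trans with (1 := HFl _ _ _); apply Rmult_le_compat_l; auto.
    + rewrite Series_scal_l; apply Rle_trans with (2 * (L * d) * (2 / m)).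
      * apply Rmult_le_compat_l; [|assumption]; assert (0 <= L * d) by now apply Rmult_le_pos. lra.
      * replace (2 * (L * d) * (2 / m)) with (4 * L * d / m) by (field; lra).
        apply Rmult_le_reg_r with m; [assumption|]; unfold Rdiv; rewrite Rmult_assoc, Rinv_l by lra.
        nra.
  - intros x t; unfold Phi; replace (_ - _) with (sine_series (fun k => c w k t) x) by ring; auto.
  - exists u; split; [assumption|]; split; [|split; [|split]].
    + exists (Mw + 2 * B * (2 / m)); intros x t; rewrite Hfix; unfold Phi.
      apply Rle_trans with (1 := Rabs_triang _ _); apply Rplus_le_compat; auto.
    + intros x Hx; rewrite Hfix; unfold Phi; rewrite Hw0 by assumption.
      unfold sine_series; rewrite (Series_ext _ (fun _ => 0 * 0)).
      * rewrite Series_scal_l; ring.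
      * intros k; unfold c; rewrite Rmax_left, duhamel_0 by lra; ring.
    + intros t; destruct (Hwb t) as [Ha Hb]; split; rewrite Hfix; unfold Phi.
      * rewrite Ha, sine_series_0; ring.
      * rewrite Hb, sine_series_1; ring.
    + intros k t Ht.
      assert (Ec : forall s, 0 <= s -> coef (fun x => u x s) k
        = exp (- kp k * s) * coef u0 k + duhamel (kp k) (fk u k) s).
      { intros s Hs.
        rewrite (coef_ext _ (fun x => w x s + 1 * sine_series (fun k => c u k s) x))
          by (intros; rewrite Hfix; unfold Phi; ring).
        rewrite coef_linear; [|apply Hw|].
        - rewrite Hwc by assumption.
          rewrite (coef_sine_series _ (fun k => 2 * B * / kp k)) by auto.
          unfold c; rewrite Rmax_right by assumption; ring.
        - intros x; apply sine_series_continuous with (fun k => 2 * B * / kp k); auto. }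
      rewrite Ec by lra.
      apply is_derive_ext_loc with (fun s => exp (- kp k * s) * coef u0 k + duhamel (kp k) (fk u k) s).
      { exists (mkposreal t Ht); intros s Hs; symmetry; apply Ec.
        revert Hs; unfold ball; simpl; unfold AbsRing_ball, abs, minus, plus, opp; simpl.
        unfold Rabs; destruct Rcase_abs; lra. }
      assert (De : is_derive (fun s => exp (- kp k * s) * coef u0 k) t
        (- kp k * exp (- kp k * t) * coef u0 k)).
      { generalize (kp k) (coef u0 k); intros p q; auto_derive; [auto|ring]. }
      assert (Dd := duhamel_derive (kp k) (fk u k) t (fun s => Hfk u k s Hu)).
      assert (Dp := is_derive_plus (V := R_NormedModule) _ _ _ _ _ De Dd).
      match type of Dp with is_derive _ _ ?l => match goal with |- is_derive _ _ ?r =>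
        replace r with l; [exact Dp|] end end.
      unfold plus; simpl; fold (fk u k t); ring.
Qed.

(** * Regularity for positive times *)

Lemma exp_neg_le_inv (y : R) : 0 < y -> exp (- y) <= / y.
Proof.
  intros Hy; rewrite exp_Ropp; apply Rinv_le_contravar; [assumption|].
  pose proof (exp_ineq1_le y); lra.
Qed.

(** The mean value theorem bounds the error of each difference quotient by [2 * m k], uniformly in
    the increment. The tail is therefore small at once, and finitely many modes remain. *)
Lemma sine_series_derive (c c' : nat -> R -> R) (m m0 : nat -> R) (t r x : R) :
  0 < r ->
  (forall k s, Rabs (s - t) < r -> is_derive (c k) s (c' k s)) ->
  (forall k s, Rabs (s - t) < r -> Rabs (c' k s) <= m k) -> ex_series m ->
  (forall k s, Rabs (s - t) < r -> Rabs (c k s) <= m0 k) -> ex_series m0 ->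
  is_derive (fun s => sine_series (fun k => c k s) x) t (sine_series (fun k => c' k t) x).
Proof.
  intros Hr Hd Hb Hm Hb0 Hm0; apply is_derive_Reals; intros eps Heps.
  assert (Htt : Rabs (t - t) < r) by (rewrite Rminus_diag, Rabs_R0; assumption).
  assert (Hm_pos : forall k, 0 <= m k)
    by (intros k; apply Rle_trans with (2 := Hb k t Htt), Rabs_pos).
  set (e := fun k h => (c k (t + h) - c k t) / h - c' k t).
  assert (Hfin : forall N eps', 0 < eps' -> exists d, 0 < d /\ forall h, h <> 0 -> Rabs h < d ->
    Rabs (sum_n (fun k => e k h * sn k x) N) < eps').
  { assert (H1 : forall k eps', 0 < eps' -> exists d, 0 < d /\ forall h, h <> 0 -> Rabs h < d ->
      Rabs (e k h * sn k x) < eps').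
    { intros k eps' He'; assert (D := Hd k t Htt); apply is_derive_Reals in D.
      destruct (D eps' He') as [d Hd']; exists d; split; [apply cond_pos|]; intros h Hh0 Hh.
      specialize (Hd' h Hh0 Hh); fold (e k h) in Hd'; rewrite Rabs_mult.
      pose proof (sn_bound k x); pose proof (Rabs_pos (sn k x)); pose proof (Rabs_pos (e k h)); nra. }
    induction N as [|N IH]; intros eps' He'.
    - destruct (H1 0%nat eps' He') as [d [Hd0 Hd1]]; exists d; split; [assumption|].
      intros h Hh0 Hh; rewrite sum_O; auto.
    - destruct (IH (eps' / 2)) as [d1 [Hd1 Hd1']]; [lra|].
      destruct (H1 (S N) (eps' / 2)) as [d2 [Hd2 Hd2']]; [lra|].
      exists (Rmin d1 d2); split; [now apply Rmin_glb_lt|]; intros h Hh0 Hh; rewrite sum_Sn.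
      apply Rle_lt_trans with (1 := Rabs_triang _ _).
      specialize (Hd1' h Hh0 (Rlt_le_trans _ _ _ Hh (Rmin_l _ _))).
      specialize (Hd2' h Hh0 (Rlt_le_trans _ _ _ Hh (Rmin_r _ _))); lra. }
  assert (Hm2 : ex_series (fun k => 2 * m k)) by exact (ex_series_scal_l (K := R_AbsRing) 2 _ Hm).
  destruct (Series_tail_small (fun k => 2 * m k) (eps / 2)) as [N HN]; [assumption| |lra|].
  { intros k; specialize (Hm_pos k); lra. }
  specialize (HN N (Nat.le_refl N)).
  destruct (Hfin N (eps / 2)) as [d [Hd0 Hd1]]; [lra|].
  exists (mkposreal (Rmin d r) (Rmin_glb_lt _ _ _ Hd0 Hr)); simpl; intros h Hh0 Hh.
  assert (Hhr := Rlt_le_trans _ _ _ Hh (Rmin_r _ _)).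
  assert (Hth : Rabs (t + h - t) < r) by (replace (t + h - t) with h by ring; assumption).
  assert (He : forall k, Rabs (e k h) <= 2 * m k).
  { intros k; destruct (MVT_gen (c k) t (t + h) (c' k)) as [z [Hz Ez]].
    - intros s Hs; apply Hd; revert Hs Hhr; unfold Rmin, Rmax, Rabs.
      repeat destruct Rle_dec; repeat destruct Rcase_abs; lra.
    - intros s Hs; apply continuity_pt_of_continuous, (ex_derive_continuous (c k)).
      eexists; apply Hd; revert Hs Hhr; unfold Rmin, Rmax, Rabs.
      repeat destruct Rle_dec; repeat destruct Rcase_abs; lra.
    - unfold e; rewrite Ez; replace (c' k z * (t + h - t) / h) with (c' k z) by (field; assumption).
      assert (Hzr : Rabs (z - t) < r).
      { revert Hz Hhr; unfold Rmin, Rmax, Rabs.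
        repeat destruct Rle_dec; repeat destruct Rcase_abs; lra. }
      generalize (Hb k z Hzr) (Hb k t Htt); unfold Rabs; repeat destruct Rcase_abs; lra. }
  assert (E : (sine_series (fun k => c k (t + h)) x - sine_series (fun k => c k t) x) / h
    - sine_series (fun k => c' k t) x = sine_series (fun k => e k h) x).
  { rewrite (sine_series_minus _ _ m0 m0) by (auto; intros k; auto).
    unfold Rdiv at 1; rewrite Rmult_comm; unfold sine_series; rewrite <- Series_scal_l, <- Series_minus.
    - apply Series_ext; intros k; unfold e; field; assumption.
    - refine (ex_series_scal_l (K := R_AbsRing) (/ h) (fun n => (c n (t + h) - c n t) * sn n x) _).
      apply ex_sine_series with (fun k => m0 k + m0 k).
      + intros k; generalize (Hb0 k (t + h) Hth) (Hb0 k t Htt).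
        unfold Rabs; repeat destruct Rcase_abs; lra.
      + exact (ex_series_plus (V := R_NormedModule) _ _ Hm0 Hm0).
    - apply ex_sine_series with m; auto. }
  rewrite E.
  assert (Hrem := sine_series_remainder (fun k => e k h) (fun k => 2 * m k) x N He Hm2).
  specialize (Hd1 h Hh0 (Rlt_le_trans _ _ _ Hh (Rmin_l _ _))).
  revert Hrem Hd1; unfold Rabs; repeat destruct Rcase_abs; lra.
Qed.

Definition spectral_solution (F : R -> R -> R) (B L m M : R) (u : R -> R -> R) : Prop :=
  bounded_lipschitz F B L /\ 0 < m /\ 8 * L <= m /\ time_continuous u /\ (forall x t, Rabs (u x t) <= M) /\
  (forall t, u 0 t = 0 /\ u 1 t = 0) /\
  (forall k t, 0 < t -> is_derive (fun s => coef (fun x => u x s) k) t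
     (- kap (m ^ 2) k * coef (fun x => u x t) k + coef (fun x => F x (u x t)) k)).

Section Regularity.

Variables (F : R -> R -> R) (B L m M : R) (u : R -> R -> R).
Hypothesis Hsol : spectral_solution F B L m M u.

Let kp (k : nat) : R := kap (m ^ 2) k.
Let c (k : nat) (t : R) : R := coef (fun x => u x t) k.
Let f (k : nat) (t : R) : R := coef (fun x => F x (u x t)) k.

Lemma spectral_kap_pos (k : nat) : 0 < kp k.
Proof. apply kap_pos, pow2_ge_0. Qed.

Lemma spectral_ex_series (b : R) : ex_series (fun k => b * / kp k).
Proof.
  destruct Hsol as [_ [Hm _]]; destruct (inv_kap_series m Hm) as [Hex _].
  exact (ex_series_scal_l (K := R_AbsRing) b _ Hex).
Qed.

Lemma spectral_coef_bounds (k : nat) (t : R) : Rabs (c k t) <= 2 * M /\ Rabs (f k t) <= 2 * B.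
Proof.
  destruct Hsol as [HF [_ [_ [Hu [HM _]]]]]; split; apply coef_bound.
  - apply Hu.
  - auto.
  - apply (time_continuous_nonlinear F u B L HF Hu).
  - intros; apply HF.
Qed.

Lemma spectral_bounds_nonneg : 0 <= M /\ 0 <= B.
Proof.
  destruct (spectral_coef_bounds 0 0) as [H1 H2].
  pose proof (Rabs_pos (c 0%nat 0)); pose proof (Rabs_pos (f 0%nat 0)); lra.
Qed.

Lemma spectral_derive (k : nat) (t : R) : 0 < t -> is_derive (c k) t (- kp k * c k t + f k t).
Proof. intros Ht; now apply Hsol. Qed.

(** The mode equation is started at [t - d / 2], which is still positive. The factor
    [exp (- kp * d / 2)] is at most [2 / (kp * d)], so the initial value, at most [2 * M],
    contributes [4 * M / d] over [kp]. *)
Lemma spectral_coef_decay (d t : R) (k : nat) :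
  0 < d -> d <= t -> Rabs (c k t) <= (4 * M / d + 2 * B) * / kp k.
Proof.
  intros Hd Ht; assert (Hkp := spectral_kap_pos k).
  destruct spectral_bounds_nonneg as [HM HB].
  assert (H := ode_bound (c k) (f k) (kp k) (t - d / 2) t (2 * B) Hkp ltac:(lra)).
  apply Rle_trans with (exp (- kp k * (t - (t - d / 2))) * Rabs (c k (t - d / 2)) + 2 * B / kp k).
  - apply H.
    + intros s Hs; apply spectral_derive; lra.
    + intros s _; apply spectral_coef_bounds.
  - replace (- kp k * (t - (t - d / 2))) with (- (kp k * (d / 2))) by field.
    assert (Hy : 0 < kp k * (d / 2)) by (apply Rmult_lt_0_compat; lra).
    assert (He := exp_neg_le_inv _ Hy); assert (He0 := exp_pos (- (kp k * (d / 2)))).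
    destruct (spectral_coef_bounds k (t - d / 2)) as [Hc _].
    apply Rle_trans with (/ (kp k * (d / 2)) * (2 * M) + 2 * B / kp k).
    + apply Rplus_le_compat_r, Rmult_le_compat; auto using Rabs_pos; lra.
    + right; field; lra.
Qed.

(** At a positive time the coefficients are summable, so the series is continuous and has the same
    coefficients as [u]; completeness of the modes concludes. *)
Lemma spectral_expansion (t x : R) :
  0 < t -> 0 <= x <= 1 -> u x t = sine_series (fun k => c k t) x.
Proof.
  intros Ht Hx; destruct Hsol as [_ [_ [_ [Hu [_ [Hb _]]]]]]; destruct (Hb t) as [Hb0 Hb1].
  assert (Hdec := fun k => spectral_coef_decay t t k Ht (Rle_refl t)).
  assert (Hex := spectral_ex_series (4 * M / t + 2 * B)).
  apply (coef_unique (fun x => u x t) (sine_series (fun k => c k t))); try assumption.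
  - apply Hu.
  - intros y; eapply sine_series_continuous; [exact Hdec|exact Hex].
  - now rewrite sine_series_0.
  - now rewrite sine_series_1.
  - intros k; symmetry; apply (coef_sine_series (fun k => c k t)) with (1 := Hdec) (2 := Hex).
Qed.

(* The difference [u (d + (1 + eta) tau) - u (d + tau)] solves an equation of the same kind
   with zero data at [tau = 0] and a forcing which is [O(eta)] up to a contribution
   controlled by the difference itself. *)
Lemma spectral_dilation_step (d eta V : R) :
  0 < d -> 0 < eta ->
  (forall x tau, 0 <= x <= 1 -> 0 <= tau -> Rabs (u x (d + (1 + eta) * tau) - u x (d + tau)) <= V) ->
  forall x tau, 0 <= x <= 1 -> 0 <= tau ->
    Rabs (u x (d + (1 + eta) * tau) - u x (d + tau))
      <= eta * (4 * M / d + 4 * B) * (2 / m) + V / 2.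
Proof.
  intros Hd Heta HV x tau Hx Htau.
  destruct Hsol as [HF [Hm [HLm [Hu _]]]].
  destruct (inv_kap_series m Hm) as [_ HE]; fold kp in HE.
  destruct spectral_bounds_nonneg as [HM HB].
  assert (HL : 0 <= L) by apply HF.
  assert (HV0 : 0 <= V) by (apply Rle_trans with (2 := HV 0 0 ltac:(lra) ltac:(lra)), Rabs_pos).
  set (A := 4 * M / d + 2 * B).
  assert (HA : 0 <= A).
  { assert (0 <= 4 * M / d) by (apply Rdiv_le_0_compat; lra); unfold A; lra. }
  assert (Hdec : forall k t, d <= t -> Rabs (c k t) <= A * / kp k)
    by (intros; now apply spectral_coef_decay).
  rewrite !spectral_expansion by nra.
  rewrite (sine_series_minus _ _ (fun k => A * / kp k) (fun k => A * / kp k));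
    try (intros k; apply Hdec; nra); try apply spectral_ex_series.
  set (G := 2 * (L * V) + eta * (A + 2 * B)).
  assert (HG : 0 <= G).
  { unfold G; assert (0 <= L * V) by now apply Rmult_le_pos.
    assert (0 <= eta * (A + 2 * B)) by (apply Rmult_le_pos; lra); lra. }
  apply Rle_trans with (Series (fun k => G * / kp k)).
  - apply sine_series_bound; [|apply spectral_ex_series]; intros k.
    assert (Hkp := spectral_kap_pos k).
    set (y := fun s => c k (d + (1 + eta) * s) - c k (d + s)).
    set (g := fun s => (f k (d + (1 + eta) * s) - f k (d + s))
      + eta * (- kp k * c k (d + (1 + eta) * s) + f k (d + (1 + eta) * s))).
    assert (H := ode_bound y g (kp k) 0 tau G Hkp Htau).
    assert (Ey : y 0 = 0) by (unfold y; rewrite Rmult_0_r; ring).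
    rewrite Ey, Rabs_R0, Rmult_0_r, Rplus_0_l in H; apply H.
    + intros s Hs; unfold y.
      assert (D1 : is_derive (fun s => c k (d + (1 + eta) * s)) s
        ((1 + eta) * (- kp k * c k (d + (1 + eta) * s) + f k (d + (1 + eta) * s)))).
      { apply (is_derive_comp (V := R_NormedModule) (c k) (fun s => d + (1 + eta) * s)).
        - apply spectral_derive; nra.
        - auto_derive; [auto|ring]. }
      assert (D2 : is_derive (fun s => c k (d + s)) s (1 * (- kp k * c k (d + s) + f k (d + s)))).
      { apply (is_derive_comp (V := R_NormedModule) (c k) (fun s => d + s)).
        - apply spectral_derive; lra.
        - auto_derive; [auto|ring]. }
      assert (D := is_derive_minus (V := R_NormedModule) _ _ _ _ _ D1 D2).
      match type of D with is_derive _ _ ?l => match goal with |- is_derive _ _ ?r =>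
        replace r with l; [exact D|] end end.
      unfold g, minus, plus, opp; simpl; ring.
    + intros s Hs; unfold g, G.
      assert (Hf1 : Rabs (f k (d + (1 + eta) * s) - f k (d + s)) <= 2 * (L * V)).
      { apply coef_dist; try apply (time_continuous_nonlinear F u B L HF Hu).
        intros z Hz; destruct HF as [_ [_ [_ HFl]]]; apply Rle_trans with (1 := HFl _ _ _).
        apply Rmult_le_compat_l; [assumption|]; apply HV; lra. }
      (* Although [kp k] is unbounded in [k], the product [kp k * c k] is at most [A] in absolute
         value after time [d], by the decay of the coefficients. *)
      assert (Hf2 : Rabs (- kp k * c k (d + (1 + eta) * s) + f k (d + (1 + eta) * s)) <= A + 2 * B).
      { apply Rle_trans with (1 := Rabs_triang _ _); apply Rplus_le_compat;
          [|apply spectral_coef_bounds].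
        rewrite Rabs_mult, Rabs_Ropp, (Rabs_right (kp k)) by lra.
        replace A with (kp k * (A * / kp k)) by (field; lra).
        apply Rmult_le_compat_l; [lra|]; apply Hdec; nra. }
      apply Rle_trans with (1 := Rabs_triang _ _); apply Rplus_le_compat; [assumption|].
      rewrite Rabs_mult, (Rabs_right eta) by lra; apply Rmult_le_compat_l; lra.
  - rewrite Series_scal_l; apply Rle_trans with (G * (2 / m)); [now apply Rmult_le_compat_l|].
    assert (HLV : 2 * (L * V) * (2 / m) <= V / 2).
    { replace (2 * (L * V) * (2 / m)) with (4 * L * V / m) by (field; lra).
      apply Rmult_le_reg_r with m; [assumption|]; unfold Rdiv; rewrite Rmult_assoc, Rinv_l by lra; nra. }
    unfold G; rewrite Rmult_plus_distr_r.
    replace (A + 2 * B) with (4 * M / d + 4 * B) by (unfold A; ring); lra.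
Qed.

(** The step turns a bound [V] into [a + V / 2]. Iterating from the crude bound [2 * M] tends to the
    fixed point [2 * a], which is linear in [eta]. *)
Lemma spectral_dilation (d eta : R) :
  0 < d -> 0 < eta -> forall x tau, 0 <= x <= 1 -> 0 <= tau ->
    Rabs (u x (d + (1 + eta) * tau) - u x (d + tau))
      <= 2 * (eta * (4 * M / d + 4 * B) * (2 / m)).
Proof.
  intros Hd Heta; set (a := eta * (4 * M / d + 4 * B) * (2 / m)).
  destruct spectral_bounds_nonneg as [HM HB].
  assert (HuM : forall x t, Rabs (u x t) <= M) by apply Hsol.
  assert (Hm : 0 < m) by apply Hsol.
  assert (Ha : 0 <= a).
  { assert (0 <= 4 * M / d) by (apply Rdiv_le_0_compat; lra).
    assert (0 < 2 / m) by (apply Rdiv_lt_0_compat; lra).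
    unfold a; repeat apply Rmult_le_pos; lra. }
  assert (Hn : forall n x tau, 0 <= x <= 1 -> 0 <= tau ->
    Rabs (u x (d + (1 + eta) * tau) - u x (d + tau)) <= 2 * a + 2 * M * (/ 2) ^ n).
  { induction n as [|n IH]; intros x tau Hx Htau.
    - rewrite pow_O; generalize (HuM x (d + (1 + eta) * tau)) (HuM x (d + tau)).
      unfold Rabs; repeat destruct Rcase_abs; lra.
    - replace (2 * a + 2 * M * (/ 2) ^ S n) with (a + (2 * a + 2 * M * (/ 2) ^ n) / 2)
        by (simpl; field).
      now apply spectral_dilation_step. }
  intros x tau Hx Htau; apply (is_lim_seq_le (fun _ => Rabs (u x (d + (1 + eta) * tau) - u x (d + tau)))
    (fun n => 2 * a + 2 * M * (/ 2) ^ n) (Rabs (u x (d + (1 + eta) * tau) - u x (d + tau))) (2 * a)).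
  - intros n; auto.
  - apply is_lim_seq_const.
  - replace (Finite (2 * a)) with (Finite (2 * a + 0)) by (f_equal; ring).
    apply is_lim_seq_plus'; [apply is_lim_seq_const|apply half_pow_lim].
Qed.

Lemma spectral_time_lipschitz (d : R) : 0 < d ->
  exists K, 0 <= K /\ forall x s t, 0 <= x <= 1 -> 2 * d <= s <= t ->
    Rabs (u x t - u x s) <= K * (t - s).
Proof.
  intros Hd; destruct spectral_bounds_nonneg as [HM HB].
  assert (Hm : 0 < m) by apply Hsol.
  set (a := 2 * ((4 * M / d + 4 * B) * (2 / m))).
  assert (Ha : 0 <= a).
  { assert (0 <= 4 * M / d) by (apply Rdiv_le_0_compat; lra).
    assert (0 < 2 / m) by (apply Rdiv_lt_0_compat; lra).
    unfold a; repeat apply Rmult_le_pos; lra. }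
  exists (a / d); split; [apply Rdiv_le_0_compat; lra|]; intros x s t Hx Hst.
  destruct (Req_dec s t) as [->|Hne]; [rewrite !Rminus_diag, Rabs_R0; lra|].
  (* With [tau = s - d] the dilated time [d + (1 + eta) * tau] is exactly [t]. Since [s >= 2 * d],
     the divisor is at least [d], hence [eta <= (t - s) / d]. *)
  set (eta := (t - s) / (s - d)).
  assert (Heta : 0 < eta) by (apply Rdiv_lt_0_compat; lra).
  assert (H := spectral_dilation d eta Hd Heta x (s - d) Hx ltac:(lra)).
  replace (d + (1 + eta) * (s - d)) with t in H by (unfold eta; field; lra).
  replace (d + (s - d)) with s in H by ring.
  apply Rle_trans with (1 := H).
  replace (2 * (eta * (4 * M / d + 4 * B) * (2 / m))) with (a * eta) by (unfold a; ring).
  replace (a / d * (t - s)) with (a * ((t - s) / d)) by (field; lra).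
  apply Rmult_le_compat_l; [assumption|]; unfold eta; apply Rmult_le_compat_l; [lra|].
  apply Rinv_le_contravar; lra.
Qed.

(* [P ((t - s) / kp + 1 / kp^2)] solves [psi' + kp psi = P (t - s)]; it dominates
   [c - f(t) / kp] because [f] is Lipschitz in time. *)
Lemma spectral_derive_decay (d : R) : 0 < d ->
  exists Q, forall k t, 3 * d <= t -> Rabs (- kp k * c k t + f k t) <= Q * / kp k.
Proof.
  intros Hd; destruct spectral_bounds_nonneg as [HM HB].
  destruct (spectral_time_lipschitz d Hd) as [K [HK Hlip]].
  destruct Hsol as [HF [Hm [HLm [Hu _]]]]; assert (HL : 0 <= L) by apply HF.
  set (A := 4 * M / d + 2 * B).
  assert (HA : 0 <= A).
  { assert (0 <= 4 * M / d) by (apply Rdiv_le_0_compat; lra); unfold A; lra. }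
  set (P := 2 * (L * K)).
  assert (HP : 0 <= P) by (assert (0 <= L * K) by (now apply Rmult_le_pos); unfold P; lra).
  (* The first term comes from the value at time [2 * d], damped during a time at least [d] because
     [t >= 3 * d]; the second is the Lipschitz contribution [P / kp ^ 2] multiplied by [kp]. *)
  exists ((A + 2 * B) / d + P); intros k t Ht.
  assert (Hkp := spectral_kap_pos k).
  assert (Hflip : forall s, 2 * d <= s <= t -> Rabs (f k s - f k t) <= P * (t - s)).
  { intros s Hs; replace (P * (t - s)) with (2 * (L * (K * (t - s)))) by (unfold P; ring).
    apply coef_dist; try apply (time_continuous_nonlinear F u B L HF Hu).
    intros z Hz; destruct HF as [_ [_ [_ HFl]]]; apply Rle_trans with (1 := HFl _ _ _).
    apply Rmult_le_compat_l; [assumption|]; rewrite Rabs_minus_sym; now apply Hlip. }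
  set (psi := fun s => P * ((t - s) / kp k + / kp k ^ 2)).
  assert (Hpsi0 : 0 <= psi (2 * d)).
  { unfold psi; apply Rmult_le_pos; [assumption|]; apply Rplus_le_le_0_compat.
    - apply Rdiv_le_0_compat; lra.
    - apply Rlt_le, Rinv_0_lt_compat, pow_lt, Hkp. }
  set (y0 := c k (2 * d) - f k t / kp k).
  assert (He := exp_pos (- kp k * (t - 2 * d))).
  assert (Hw : forall sg, sg = 1 \/ sg = -1 -> sg * (c k t - f k t / kp k)
    <= exp (- kp k * (t - 2 * d)) * Rabs y0 + P / kp k ^ 2).
  { intros sg Hsg.
    assert (H := ode_decay (fun s => sg * (c k s - f k t / kp k) - psi s)
      (fun s => sg * (- kp k * c k s + f k s) + P / kp k) (kp k) (2 * d) t ltac:(lra)).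
    cut (sg * (c k t - f k t / kp k) - psi t
      <= exp (- kp k * (t - 2 * d)) * (sg * y0 - psi (2 * d))).
    - assert (Et : psi t = P / kp k ^ 2) by (unfold psi; field; lra); rewrite Et.
      assert (sg * y0 <= Rabs y0)
        by (unfold Rabs; destruct Rcase_abs; destruct Hsg as [-> | ->]; lra).
      nra.
    - apply H.
      + intros s Hs.
        assert (D1 := is_derive_scal (c k) s sg _ (spectral_derive k s ltac:(lra))).
        assert (D2 : is_derive (fun s => - (sg * (f k t / kp k)) - psi s) s (P / kp k)).
        { unfold psi; generalize (f k t) (kp k) Hkp; intros p q Hq; auto_derive; [auto|field; lra]. }
        assert (D := is_derive_plus (V := R_NormedModule) _ _ _ _ _ D1 D2).
        apply (is_derive_ext (fun s => plus (sg * c k s) (- (sg * (f k t / kp k)) - psi s)));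
          [|exact D].
        intros r; unfold plus; simpl; ring.
      + intros s Hs; assert (Hfl := Hflip s Hs).
        replace (_ + _) with (sg * (f k s - f k t) - P * (t - s)) by (unfold psi; field; lra).
        revert Hfl; unfold Rabs; destruct Rcase_abs; destruct Hsg as [-> | ->]; lra. }
  assert (Hy : Rabs (c k t - f k t / kp k) <= exp (- kp k * (t - 2 * d)) * Rabs y0 + P / kp k ^ 2).
  { generalize (Hw 1 ltac:(auto)) (Hw (-1) ltac:(auto)); unfold Rabs at 3; destruct Rcase_abs; lra. }
  replace (- kp k * c k t + f k t) with (- kp k * (c k t - f k t / kp k)) by (field; lra).
  rewrite Rabs_mult, Rabs_Ropp, (Rabs_right (kp k)) by lra.
  assert (Hy0 : Rabs y0 <= (A + 2 * B) * / kp k).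
  { unfold y0; apply Rle_trans with (1 := Rabs_triang _ _); rewrite Rabs_Ropp, Rmult_plus_distr_r.
    apply Rplus_le_compat; [apply spectral_coef_decay; lra|].
    unfold Rdiv; rewrite Rabs_mult, (Rabs_right (/ kp k)).
    - apply Rmult_le_compat_r; [now apply Rlt_le, Rinv_0_lt_compat|apply spectral_coef_bounds].
    - now apply Rle_ge, Rlt_le, Rinv_0_lt_compat. }
  assert (Hexp : exp (- kp k * (t - 2 * d)) <= / (kp k * d)).
  { apply Rle_trans with (exp (- (kp k * (t - 2 * d)))); [right; f_equal; ring|].
    apply Rle_trans with (/ (kp k * (t - 2 * d))).
    - apply exp_neg_le_inv, Rmult_lt_0_compat; lra.
    - apply Rinv_le_contravar; [apply Rmult_lt_0_compat; lra|]; apply Rmult_le_compat_l; lra. }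
  apply Rle_trans with (kp k * (/ (kp k * d) * ((A + 2 * B) * / kp k) + P / kp k ^ 2)).
  - apply Rmult_le_compat_l; [lra|]; apply Rle_trans with (1 := Hy).
    apply Rplus_le_compat_r, Rmult_le_compat; auto using Rabs_pos; lra.
  - right; field; lra.
Qed.

Lemma spectral_time_derive (x t : R) : 0 <= x <= 1 -> 0 < t ->
  (exists Q, forall k, Rabs (- kp k * c k t + f k t) <= Q * / kp k) /\
  is_derive (fun s => u x s) t (sine_series (fun k => - kp k * c k t + f k t) x).
Proof.
  intros Hx Ht.
  (* Decay then holds from [3 * (t / 6) = t / 2] on, that is, throughout the neighbourhood of radius
     [t / 2] used for termwise differentiation. *)
  destruct (spectral_derive_decay (t / 6)) as [Q HQ]; [lra|].
  split; [exists Q; intros k; apply HQ; lra|].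
  assert (Hnear : forall s, Rabs (s - t) < t / 2 -> t / 2 <= s)
    by (intros s; unfold Rabs; destruct Rcase_abs; lra).
  apply is_derive_ext_loc with (fun s => sine_series (fun k => c k s) x).
  { exists (mkposreal (t / 2) ltac:(lra)); intros s Hs; symmetry; apply spectral_expansion; [|assumption].
    specialize (Hnear s Hs); lra. }
  apply (sine_series_derive c (fun k s => - kp k * c k s + f k s)
    (fun k => Q * / kp k) (fun k => (4 * M / (t / 2) + 2 * B) * / kp k) t (t / 2));
    try apply spectral_ex_series; try lra; intros k s Hs; specialize (Hnear s Hs).
  - apply spectral_derive; lra.
  - apply HQ; lra.
  - apply spectral_coef_decay; lra.
Qed.

End Regularity.

(** * Recovery of the second space derivative *)

Lemma is_derive_primitive (g : R -> R) (x : R) :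
  (forall y, continuous g y) -> is_derive (fun b => RInt g 0 b) x (g x).
Proof.
  intros Hg; apply (is_derive_RInt (V := R_NormedModule) g (fun b => RInt g 0 b) 0 x); [|apply Hg].
  exists (mkposreal 1 Rlt_0_1); intros b _.
  apply (RInt_correct (V := R_CompleteNormedModule)).
  apply (ex_RInt_continuous (V := R_CompleteNormedModule)); intros; apply Hg.
Qed.

(** Green's identity: [w1 * sn k - w * (sn k)'] is a primitive of [(w2 + b ^ 2 * w) * sn k], and its
    boundary values vanish because [w] and [sn k] do. *)
Lemma coef_second_derivative (w w1 w2 : R -> R) (k : nat) :
  (forall x, is_derive w x (w1 x)) -> (forall x, is_derive w1 x (w2 x)) ->
  (forall x, continuous w2 x) -> w 0 = 0 -> w 1 = 0 ->
  coef w2 k = - (INR (S k) * PI) ^ 2 * coef w k.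
Proof.
  intros H1 H2 Hc E0 E1; set (b := INR (S k) * PI).
  assert (Hcw : forall x, continuous w x)
    by (intros x; apply (ex_derive_continuous w); eexists; apply H1).
  assert (Hint : is_RInt (fun x => (w2 x + b ^ 2 * w x) * sn k x) 0 1
    (minus (w1 1 * sn k 1 - w 1 * (b * cos (b * 1))) (w1 0 * sn k 0 - w 0 * (b * cos (b * 0))))).
  { apply (is_RInt_derive (V := R_CompleteNormedModule)
      (fun x => w1 x * sn k x - w x * (b * cos (b * x)))).
    - intros x _.
      assert (Da := is_derive_mult _ _ _ _ _ (H2 x) (sn_derive k x) Rmult_comm).
      assert (Dc : is_derive (fun x => b * cos (b * x)) x (- b ^ 2 * sn k x)).
      { unfold sn; fold b; generalize b; intros b'; auto_derive; [auto|ring]. }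
      assert (Db := is_derive_mult _ _ _ _ _ (H1 x) Dc Rmult_comm).
      assert (D := is_derive_minus (V := R_NormedModule) _ _ _ _ _ Da Db).
      match type of D with is_derive _ _ ?l => match goal with |- is_derive _ _ ?r =>
        replace r with l; [exact D|] end end.
      unfold minus, plus, opp, mult; simpl; fold (INR (S k)); unfold b; simpl; ring.
    - intros x _; apply (continuous_mult (fun x => w2 x + b ^ 2 * w x) (sn k)); [|apply sn_continuous].
      apply (continuous_plus w2 (fun x => b ^ 2 * w x)); [apply Hc|].
      apply (continuous_mult (fun _ => b ^ 2) w); [apply continuous_const|apply Hcw]. }
  apply (is_RInt_unique (V := R_CompleteNormedModule)) in Hint.
  rewrite sn_0, sn_1, E0, E1 in Hint.
  assert (E : coef (fun x => w2 x + b ^ 2 * w x) k = 0).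
  { unfold coef; rewrite Hint; unfold minus, plus, opp; simpl; ring. }
  rewrite coef_linear in E by assumption; lra.
Qed.

Lemma spectral_regularity (F : R -> R -> R) (B L m M : R) (u : R -> R -> R) :
  spectral_solution F B L m M u ->
  exists ut ux uxx : R -> R -> R, forall x t, 0 < x < 1 -> 0 < t ->
    is_derive (fun s => u x s) t (ut x t) /\ is_derive (fun y => u y t) x (ux x t) /\
    is_derive (fun y => ux y t) x (uxx x t) /\
    ut x t - uxx x t = - m ^ 2 * u x t + F x (u x t).
Proof.
  intros Hsol.
  set (kp := kap (m ^ 2)); set (c := fun k t => coef (fun x => u x t) k).
  set (f := fun k t => coef (fun x => F x (u x t)) k).
  set (ut := fun x t => sine_series (fun k => - kp k * c k t + f k t) x).
  set (g := fun t x => ut x t + m ^ 2 * u x t - F x (u x t)).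
  set (G := fun t x => RInt (g t) 0 x).
  exists ut, (fun x t => G t x - RInt (G t) 0 1), (fun x t => g t x).
  intros x t Hx Ht.
  destruct (spectral_time_derive F B L m M u Hsol x t ltac:(lra) Ht) as [[Q HQ] Dt].
  assert (Hex := spectral_ex_series F B L m M u Hsol Q).
  fold kp in HQ, Dt, Hex.
  assert (HF : bounded_lipschitz F B L) by apply Hsol.
  assert (Hu : time_continuous u) by apply Hsol.
  assert (HFu := time_continuous_nonlinear F u B L HF Hu).
  assert (Hut : forall y, continuous (fun y => ut y t) y)
    by (intros y; eapply sine_series_continuous; [exact HQ|exact Hex]).
  assert (Hg0 : forall y, continuous (fun y => ut y t + m ^ 2 * u y t) y).
  { intros y; apply (continuous_plus (fun y => ut y t) (fun y => m ^ 2 * u y t)); [apply Hut|].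
    apply (continuous_mult (fun _ => m ^ 2) (fun y => u y t)); [apply continuous_const|apply Hu]. }
  assert (Hg : forall y, continuous (g t) y).
  { intros y; apply (continuous_minus (fun y => ut y t + m ^ 2 * u y t) (fun y => F y (u y t)));
      [apply Hg0|apply HFu]. }
  assert (DG : forall y, is_derive (G t) y (g t y)) by (intros y; now apply is_derive_primitive).
  assert (HG : forall y, continuous (G t) y)
    by (intros y; apply (ex_derive_continuous (G t)); eexists; apply DG).
  (* The linear term makes the double primitive vanish at [1], as [u] does. *)
  set (w := fun y => RInt (G t) 0 y - y * RInt (G t) 0 1).
  set (w1 := fun y => G t y - RInt (G t) 0 1).
  assert (Dw : forall y, is_derive w y (w1 y)).
  { intros y; apply (is_derive_minus (V := R_NormedModule) (fun y => RInt (G t) 0 y)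
      (fun y => y * RInt (G t) 0 1)); [now apply is_derive_primitive|].
    generalize (RInt (G t) 0 1); intros r; auto_derive; [auto|ring]. }
  assert (Dw1 : forall y, is_derive w1 y (g t y)).
  { intros y; replace (g t y) with (minus (g t y) 0) by (unfold minus, plus, opp; simpl; ring).
    apply (is_derive_minus (V := R_NormedModule) (G t) (fun _ => RInt (G t) 0 1)); [apply DG|].
    apply (is_derive_const (V := R_NormedModule)). }
  assert (Ew0 : w 0 = 0).
  { unfold w; rewrite RInt_point; change (0 - 0 * RInt (G t) 0 1 = 0); ring. }
  assert (Ew1 : w 1 = 0) by (unfold w; ring).
  assert (Euw : forall y, 0 <= y <= 1 -> u y t = w y).
  { destruct Hsol as [_ [_ [_ [_ [_ [Hb _]]]]]]; destruct (Hb t) as [Hb0 Hb1].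
    apply (coef_unique (fun y => u y t) w).
    - apply Hu.
    - intros y; apply (ex_derive_continuous w); eexists; apply Dw.
    - now rewrite Ew0.
    - now rewrite Ew1.
    (* In the coefficient of [g t] the forcing [f] and the terms in [m ^ 2] cancel, leaving
       [- (INR (S k) * PI) ^ 2 * c k t]. By Green's identity it is also that factor times the
       coefficient of [w]. *)
    - intros k; assert (E := coef_second_derivative w w1 (g t) k Dw Dw1 Hg Ew0 Ew1).
      unfold g in E; rewrite coef_minus, coef_linear in E; try assumption; try apply Hu; try apply HFu.
      assert (Es : coef (fun y => ut y t) k = - kp k * c k t + f k t)
        by exact (coef_sine_series (fun k => - kp k * c k t + f k t) _ k HQ Hex).
      rewrite Es in E.
      fold (c k t) (f k t) in E |- *; unfold kp, kap in E.
      assert (Hpos : 0 < (INR (S k) * PI) ^ 2).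
      { apply pow_lt, Rmult_lt_0_compat; [apply lt_0_INR; lia|apply PI_RGT_0]. }
      apply Rmult_eq_reg_l with ((INR (S k) * PI) ^ 2); lra. }
  split; [exact Dt|]; split; [|split; [apply Dw1|unfold g; ring]].
  apply is_derive_ext_loc with w; [|apply Dw].
  exists (mkposreal (Rmin x (1 - x)) (Rmin_glb_lt x (1 - x) 0 ltac:(lra) ltac:(lra))).
  intros y Hy; symmetry; apply Euw.
  assert (Ha := Rlt_le_trans _ _ _ Hy (Rmin_l _ _)); assert (Hb := Rlt_le_trans _ _ _ Hy (Rmin_r _ _)).
  revert Ha Hb; unfold abs, minus, plus, opp; simpl; unfold Rabs; destruct Rcase_abs; lra.
Qed.

(** * Comparison and decay *)

Lemma cont_on01_clamp (g : R -> R) :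
  cont_on01 g -> forall x, continuous (fun y => g (clamp 0 1 y)) x.
Proof.
  intros Hg x; apply continuous_eps; intros eps Heps.
  destruct (Hg (clamp 0 1 x) (clamp_bounds 0 1 x Rle_0_1) eps Heps) as [d [Hd Hd']].
  exists d; split; [assumption|]; intros y Hy; apply Hd'; [apply clamp_bounds, Rle_0_1|].
  apply Rle_lt_trans with (1 := clamp_lipschitz _ _ _ _); assumption.
Qed.

Lemma cont_on01_bounded (g : R -> R) :
  cont_on01 g -> exists M, 0 < M /\ forall x, 0 <= x <= 1 -> Rabs (g x) <= M.
Proof.
  intros Hg; destruct (continuous_bounded _ 0 1 Rle_0_1 (cont_on01_clamp g Hg)) as [M HM].
  exists (Rabs M + 1); split; [pose proof (Rabs_pos M); lra|]; intros x Hx.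
  specialize (HM x Hx); rewrite clamp_id in HM by assumption; pose proof (Rle_abs M); lra.
Qed.

Lemma cont_rect_bounded (u : R -> R -> R) (A B T : R) :
  A <= B -> 0 <= T -> cont_rect u A B T ->
  exists U, 0 <= U /\ forall x t, A <= x <= B -> 0 <= t <= T -> Rabs (u x t) <= U.
Proof.
  intros HAB HT Hu.
  destruct (rect_max (fun x t => Rabs (u (clamp A B x) (clamp 0 T t))) A B T HAB HT)
    as [x0 [t0 [_ [_ H]]]].
  - intros x t; apply (continuity_1d_2d_pt_comp Rabs).
    + apply continuity_pt_of_continuous, continuous_Rabs.
    + now apply cont_rect_clamp.
  - eexists; split; [|intros x t Hx Ht; specialize (H x t Hx Ht)].
    + apply (Rabs_pos (u (clamp A B x0) (clamp 0 T t0))).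
    + now rewrite !clamp_id in H by assumption.
Qed.

Lemma cont_rect_affine (u : R -> R -> R) (sg A B T : R) (h : R -> R) :
  cont_rect u A B T -> (forall x, continuous h x) ->
  cont_rect (fun x t => sg * u x t + h x) A B T.
Proof.
  intros Hu Hh x t Hx Ht eps Heps; pose proof (Rabs_pos sg) as Hsg.
  destruct (Hu x t Hx Ht (eps / 2 / (Rabs sg + 1))) as [d [Hd Hd']]; [apply Rdiv_lt_0_compat; lra|].
  destruct (proj1 (continuous_eps _ _) (Hh x) (eps / 2)) as [e [He He']]; [lra|].
  exists (Rmin d e); split; [now apply Rmin_glb_lt|]; intros y s Hy Hs H1 H2.
  specialize (Hd' y s Hy Hs (Rlt_le_trans _ _ _ H1 (Rmin_l _ _)) (Rlt_le_trans _ _ _ H2 (Rmin_l _ _))).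
  specialize (He' y (Rlt_le_trans _ _ _ H1 (Rmin_r _ _))).
  replace (sg * u y s + h y - (sg * u x t + h x)) with (sg * (u y s - u x t) + (h y - h x)) by ring.
  apply Rle_lt_trans with (1 := Rabs_triang _ _); rewrite Rabs_mult.
  pose proof (Rabs_pos (u y s - u x t)).
  assert (E : (Rabs sg + 1) * (eps / 2 / (Rabs sg + 1)) = eps / 2) by (field; lra); nra.
Qed.

(** The sign serves both directions: [sg = 1] with [h] minus a barrier gives upper bounds, [sg = -1]
    with [h = 0] gives nonnegativity. All barriers in use are independent of time. *)
Lemma barrier_comparison (u ut ux uxx N : R -> R -> R) (h h1 h2 : R -> R) (sg A B T C : R) :
  A < B -> 0 < T -> cont_rect u A B T ->
  (forall x t, A < x < B -> 0 < t < T ->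
     is_derive (fun s => u x s) t (ut x t) /\ is_derive (fun y => u y t) x (ux x t) /\
     is_derive (fun y => ux y t) x (uxx x t) /\ ut x t - uxx x t = N x t) ->
  (forall x, is_derive h x (h1 x)) -> (forall x, is_derive h1 x (h2 x)) ->
  (forall x t, A < x < B -> 0 < t < T -> 0 < sg * u x t + h x ->
     sg * N x t - h2 x <= C * (sg * u x t + h x)) ->
  (forall x, A <= x <= B -> sg * u x 0 + h x <= 0) ->
  (forall t, 0 <= t <= T -> sg * u A t + h A <= 0 /\ sg * u B t + h B <= 0) ->
  forall x t, A <= x <= B -> 0 <= t <= T -> sg * u x t + h x <= 0.
Proof.
  intros HAB HT Hu Hd Hh1 Hh2 HN.
  apply (max_principle (fun x t => sg * u x t + h x) (fun x t => sg * ut x t + 0)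
    (fun x t => sg * ux x t + h1 x) (fun x t => sg * uxx x t + h2 x) A B T C HAB HT).
  - apply cont_rect_affine; [assumption|]; intros x; apply (ex_derive_continuous h).
    eexists; apply Hh1.
  - intros x t Hx Ht; destruct (Hd x t Hx Ht) as [D1 [D2 [D3 _]]]; split; [|split].
    + apply (is_derive_plus (V := R_NormedModule) (fun s => sg * u x s) (fun _ => h x)).
      * now apply is_derive_scal.
      * apply (is_derive_const (V := R_NormedModule)).
    + apply (is_derive_plus (V := R_NormedModule) (fun y => sg * u y t) h); [|apply Hh1].
      now apply (is_derive_scal (fun y => u y t)).
    + apply (is_derive_plus (V := R_NormedModule) (fun y => sg * ux y t) h1); [|apply Hh2].
      now apply (is_derive_scal (fun y => ux y t)).
  - intros x t Hx Ht Hpos; destruct (Hd x t Hx Ht) as [_ [_ [_ E]]].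
    specialize (HN x t Hx Ht Hpos); rewrite <- E in HN; lra.
Qed.

Lemma is_derive_cst (c x : R) : is_derive (fun _ => c) x 0.
Proof. apply (is_derive_const (V := R_NormedModule)). Qed.

Lemma parabolic_solution_derive (a : R -> R) (lambda : R) (u0 : R -> R) (T : R) (u : R -> R -> R) :
  parabolic_solution a lambda u0 T u ->
  exists ut ux uxx : R -> R -> R, forall x t, 0 < x < 1 -> 0 < t < T ->
    is_derive (fun s => u x s) t (ut x t) /\ is_derive (fun y => u y t) x (ux x t) /\
    is_derive (fun y => ux y t) x (uxx x t) /\
    ut x t - uxx x t = lambda * u x t + a x * u x t ^ 2.
Proof.
  intros [_ [H _]].
  exists (fun x t => Derive (fun s => u x s) t), (fun x t => Derive (fun y => u y t) x),
    (fun x t => Derive_n (fun y => u y t) 2 x).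
  intros x t Hx Ht; destruct (H x t Hx Ht) as [H1 [H2 [H3 H4]]].
  split; [now apply Derive_correct|]; split; [now apply Derive_correct, H2|].
  split; [exact (Derive_correct _ _ H3)|assumption].
Qed.

(** The constant in the maximum principle may depend on the solution, so the bound [U] that
    continuity gives for this particular [u] suffices. For [u < 0] the quadratic term is at most
    [Ma * U * - u]; for [u > K] the right-hand side is at most [Ma * u * (u - K)]. *)
Lemma parabolic_bounds (a : R -> R) (lambda : R) (u0 : R -> R) (T : R) (u : R -> R -> R) (Ma K : R) :
  0 < T -> 0 <= Ma -> 0 <= K -> (forall x, 0 <= x <= 1 -> Rabs (a x) <= Ma) ->
  (forall x, 0 <= x <= 1 -> 0 <= u0 x <= K) -> u0 0 = 0 -> u0 1 = 0 -> lambda <= - (Ma * K) ->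
  parabolic_solution a lambda u0 T u ->
  forall x t, 0 <= x <= 1 -> 0 <= t <= T -> 0 <= u x t <= K.
Proof.
  intros HT HMa HK Ha Hu0 E0 E1 Hlam Hsol.
  destruct (parabolic_solution_derive _ _ _ _ _ Hsol) as [ut [ux [uxx Hder]]].
  destruct Hsol as [Hc [_ [Hb Hi]]]; change (cont_rect u 0 1 T) in Hc.
  assert (Hbd : forall t, 0 <= t <= T -> u 0 t = 0 /\ u 1 t = 0).
  { intros t Ht; destruct (Req_dec t 0) as [->|Hne]; [rewrite !Hi by lra; auto|apply Hb; lra]. }
  destruct (cont_rect_bounded u 0 1 T Rle_0_1 ltac:(lra) Hc) as [U [HU0 HU]].
  assert (Habs : forall x, 0 < x < 1 -> - Ma <= a x <= Ma)
    by (intros x Hx; apply Rabs_le_between, Ha; lra).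
  assert (Hpos : forall x t, 0 <= x <= 1 -> 0 <= t <= T -> 0 <= u x t).
  { intros x t Hx Ht; cut (-1 * u x t + 0 <= 0); [lra|].
    apply (barrier_comparison u ut ux uxx (fun x t => lambda * u x t + a x * u x t ^ 2)
      (fun _ => 0) (fun _ => 0) (fun _ => 0) (-1) 0 1 T (Ma * U)); auto using Rlt_0_1, is_derive_cst.
    - intros y s Hy Hs Hneg; specialize (Habs y Hy).
      assert (HUy := proj1 (Rabs_le_between _ _) (HU y s ltac:(lra) ltac:(lra))).
      set (v := u y s) in *.
      assert (Hav : 0 <= Ma + a y) by lra.
      assert (HMaU : 0 <= Ma * (U + v)) by (apply Rmult_le_pos; lra).
      assert (Hl : lambda <= 0) by (assert (0 <= Ma * K) by (now apply Rmult_le_pos); lra).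
      assert (H1 : - (a y * v ^ 2) <= Ma * v ^ 2) by (pose proof (pow2_ge_0 v); nra).
      assert (H2 : Ma * v ^ 2 <= Ma * U * - v) by nra.
      assert (H3 : - (lambda * v) <= 0) by nra.
      lra.
    - intros y Hy; rewrite Hi by assumption; specialize (Hu0 y Hy); lra.
    - intros s Hs; destruct (Hbd s Hs) as [-> ->]; lra. }
  intros x t Hx Ht; split; [now apply Hpos|].
  cut (1 * u x t + - K <= 0); [lra|].
  apply (barrier_comparison u ut ux uxx (fun x t => lambda * u x t + a x * u x t ^ 2)
    (fun _ => - K) (fun _ => 0) (fun _ => 0) 1 0 1 T (Ma * U)); auto using Rlt_0_1, is_derive_cst.
  - intros y s Hy Hs Hgt; specialize (Habs y Hy).
    assert (HUy := proj1 (Rabs_le_between _ _) (HU y s ltac:(lra) ltac:(lra))).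
    set (v := u y s) in *.
    assert (H1 : a y * v ^ 2 <= Ma * v ^ 2) by (pose proof (pow2_ge_0 v); nra).
    assert (H2 : lambda * v <= - (Ma * K) * v) by (apply Rmult_le_compat_r; lra).
    assert (H3 : Ma * (v - K) * v <= Ma * (v - K) * U)
      by (apply Rmult_le_compat_l; [apply Rmult_le_pos; lra|lra]).
    lra.
  - intros y Hy; rewrite Hi by assumption; specialize (Hu0 y Hy); lra.
  - intros s Hs; destruct (Hbd s Hs) as [-> ->]; lra.
Qed.

(** On each lateral side one of the exponentials equals 1, so the barrier exceeds [K] there and only
    the global bound on [u] is used. Since [h'' = q ^ 2 * h], the inequality inside reduces to
    [- q ^ 2 * (u + h) <= 0]. *)
Lemma parabolic_decay (a : R -> R) (lambda : R) (u0 : R -> R) (T : R) (u : R -> R -> R)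
    (Ma K q l r : R) :
  0 < T -> 0 <= Ma -> 0 <= K -> (forall x, 0 <= x <= 1 -> Rabs (a x) <= Ma) ->
  (forall x, 0 <= x <= 1 -> 0 <= u0 x <= K) -> u0 0 = 0 -> u0 1 = 0 ->
  lambda <= - (Ma * K) - q ^ 2 ->
  0 <= l -> l < r -> r <= 1 -> (forall x, l < x < r -> u0 x = 0) ->
  parabolic_solution a lambda u0 T u ->
  forall x t, l <= x <= r -> 0 <= t <= T ->
    0 <= u x t <= K * (exp (- q * (x - l)) + exp (- q * (r - x))).
Proof.
  intros HT HMa HK Ha Hu0 E0 E1 Hlam Hl Hlr Hr Hz Hsol.
  assert (Hbnd := parabolic_bounds a lambda u0 T u Ma K HT HMa HK Ha Hu0 E0 E1
    ltac:(pose proof (pow2_ge_0 q); lra) Hsol).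
  destruct (parabolic_solution_derive _ _ _ _ _ Hsol) as [ut [ux [uxx Hder]]].
  destruct Hsol as [Hc [_ [_ Hi]]].
  intros x t Hx Ht; split; [apply Hbnd; lra|].
  set (h := fun x => - (K * (exp (- q * (x - l)) + exp (- q * (r - x))))).
  assert (Hhl : h l <= - K).
  { unfold h; rewrite Rminus_diag, Rmult_0_r, exp_0; pose proof (exp_pos (- q * (r - l))); nra. }
  assert (Hhr : h r <= - K).
  { unfold h; rewrite Rminus_diag, Rmult_0_r, exp_0; pose proof (exp_pos (- q * (r - l))); nra. }
  cut (1 * u x t + h x <= 0); [unfold h; lra|].
  apply (barrier_comparison u ut ux uxx (fun x t => lambda * u x t + a x * u x t ^ 2)
    h (fun x => K * q * (exp (- q * (x - l)) - exp (- q * (r - x)))) (fun x => q ^ 2 * h x)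
    1 l r T 0); try assumption.
  - intros y s Hy Hs eps Heps; destruct (Hc y s ltac:(lra) Hs eps Heps) as [d [Hd Hd']].
    exists d; split; [assumption|]; intros; apply Hd'; lra.
  - intros y s Hy Hs; apply Hder; lra.
  - intros y; unfold h; auto_derive; [auto|unfold Rminus; ring].
  - intros y; unfold h; auto_derive; [auto|unfold Rminus; ring].
  - intros y s Hy Hs Hpos.
    assert (Hb := Hbnd y s ltac:(lra) ltac:(lra)).
    assert (Hay := proj1 (Rabs_le_between _ _) (Ha y ltac:(lra))).
    set (v := u y s) in *.
    assert (H1 : a y * v ^ 2 <= Ma * v ^ 2) by (pose proof (pow2_ge_0 v); nra).
    assert (H2 : Ma * v ^ 2 <= Ma * K * v).
    { replace (Ma * v ^ 2) with (Ma * v * v) by ring.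
      replace (Ma * K * v) with (Ma * v * K) by ring.
      apply Rmult_le_compat_l; [apply Rmult_le_pos; lra|lra]. }
    assert (H3 : lambda * v <= (- (Ma * K) - q ^ 2) * v) by (apply Rmult_le_compat_r; lra).
    assert (H4 : 0 <= q ^ 2 * (1 * v + h y)) by (apply Rmult_le_pos; [apply pow2_ge_0|lra]).
    lra.
  (* The initial value is known to vanish only on the open interval; at the two ends [u0 <= K] and
     the barrier is at least [K]. *)
  - intros y Hy; rewrite Hi by lra.
    destruct (Req_dec y l) as [->|Hyl]; [specialize (Hu0 l ltac:(lra)); lra|].
    destruct (Req_dec y r) as [->|Hyr]; [specialize (Hu0 r ltac:(lra)); lra|].
    rewrite Hz by lra; unfold h.
    pose proof (exp_pos (- q * (y - l))); pose proof (exp_pos (- q * (r - y))); nra.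
  - intros s Hs; generalize (Hbnd l s ltac:(lra) Hs) (Hbnd r s ltac:(lra) Hs); lra.
Qed.

(** * Existence by truncation *)

Lemma truncated_bounded_lipschitz (a : R -> R) (Ma K : R) :
  cont_on01 a -> 0 <= Ma -> 0 <= K -> (forall x, 0 <= x <= 1 -> Rabs (a x) <= Ma) ->
  bounded_lipschitz (fun x v => a (clamp 0 1 x) * clamp 0 K v ^ 2) (Ma * K ^ 2) (2 * (Ma * K)).
Proof.
  intros Hac HMa HK Ha.
  assert (Hb : forall x, Rabs (a (clamp 0 1 x)) <= Ma)
    by (intros x; apply Ha, clamp_bounds, Rle_0_1).
  assert (HMK : 0 <= Ma * K) by now apply Rmult_le_pos.
  split; [|split; [|split; [lra|]]].
  - intros v x; apply (continuous_mult (fun y => a (clamp 0 1 y)) (fun _ => clamp 0 K v ^ 2)).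
    + now apply cont_on01_clamp.
    + apply continuous_const.
  - intros x v; rewrite Rabs_mult; apply Rmult_le_compat; auto using Rabs_pos.
    assert (Hv := clamp_bounds 0 K v HK).
    rewrite Rabs_right by (apply Rle_ge, pow2_ge_0); apply pow_incr; lra.
  - intros x v w; assert (Hv := clamp_bounds 0 K v HK); assert (Hw := clamp_bounds 0 K w HK).
    replace (a (clamp 0 1 x) * clamp 0 K v ^ 2 - a (clamp 0 1 x) * clamp 0 K w ^ 2)
      with (a (clamp 0 1 x) * ((clamp 0 K v + clamp 0 K w) * (clamp 0 K v - clamp 0 K w))) by ring.
    rewrite !Rabs_mult, (Rabs_right (_ + _)) by lra.
    assert (Hl := clamp_lipschitz 0 K v w).
    replace (2 * (Ma * K) * Rabs (v - w)) with (Ma * (2 * K * Rabs (v - w))) by ring.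
    apply Rmult_le_compat; auto using Rabs_pos.
    + apply Rmult_le_pos; [lra|apply Rabs_pos].
    + apply Rmult_le_compat; auto using Rabs_pos; lra.
Qed.

(** The bound [16 * (Ma * K) <= m] is the contraction condition for the Lipschitz constant
    [2 * (Ma * K)], and [Ma * K <= m ^ 2] makes [K] a supersolution. The truncated term is [0] below
    [0] and [a * K ^ 2] above [K], so the maximum principle applies with constant [0]. *)
Lemma parabolic_existence (a : R -> R) (u0 : R -> R) (Ma K m : R) :
  cont_on01 a -> cont_on01 u0 -> 0 <= Ma -> 0 <= K ->
  (forall x, 0 <= x <= 1 -> Rabs (a x) <= Ma) ->
  (forall x, 0 <= x <= 1 -> 0 <= u0 x <= K) -> u0 0 = 0 -> u0 1 = 0 ->
  0 < m -> 16 * (Ma * K) <= m -> Ma * K <= m ^ 2 ->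
  exists u, parabolic_solution a (- m ^ 2) u0 1 u.
Proof.
  intros Hac Huc HMa HK Ha Hu0 E0 E1 Hm Hm1 Hm2.
  set (F := fun x v => a (clamp 0 1 x) * clamp 0 K v ^ 2).
  assert (HF : bounded_lipschitz F (Ma * K ^ 2) (2 * (Ma * K)))
    by now apply truncated_bounded_lipschitz.
  destruct (mild_solution F (Ma * K ^ 2) (2 * (Ma * K)) m (fun x => u0 (clamp 0 1 x)) HF Hm)
    as [u [Hu [[M HM] [Hi [Hb Hode]]]]].
  { lra. }
  { now apply cont_on01_clamp. }
  { now rewrite clamp_id by lra. }
  { now rewrite clamp_id by lra. }
  assert (Hi' : forall x, 0 <= x <= 1 -> u x 0 = u0 x).
  { intros x Hx; rewrite Hi by assumption; now rewrite clamp_id. }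
  destruct (spectral_regularity F (Ma * K ^ 2) (2 * (Ma * K)) m M u) as [ut [ux [uxx Hreg]]].
  { repeat (split; [assumption || lra|]); assumption. }
  assert (Hc : cont_rect u 0 1 1) by now apply time_continuous_cont_rect.
  assert (Hd : forall x t, 0 < x < 1 -> 0 < t < 1 ->
    is_derive (fun s => u x s) t (ut x t) /\ is_derive (fun y => u y t) x (ux x t) /\
    is_derive (fun y => ux y t) x (uxx x t) /\
    ut x t - uxx x t = - m ^ 2 * u x t + F x (u x t))
    by (intros x t Hx Ht; apply Hreg; lra).
  assert (Hrange : forall x t, 0 <= x <= 1 -> 0 <= t <= 1 -> 0 <= u x t <= K).
  { intros x t Hx Ht; split.
    - cut (-1 * u x t + 0 <= 0); [lra|].
      apply (barrier_comparison u ut ux uxx (fun x t => - m ^ 2 * u x t + F x (u x t))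
        (fun _ => 0) (fun _ => 0) (fun _ => 0) (-1) 0 1 1 0); auto using Rlt_0_1, is_derive_cst.
      + intros y s _ _ Hneg; set (v := u y s) in *.
        assert (Ev : clamp 0 K v = 0)
          by (unfold clamp, Rmax, Rmin; repeat destruct Rle_dec; lra).
        unfold F; rewrite Ev; pose proof (pow2_ge_0 m); nra.
      + intros y Hy; rewrite Hi' by assumption; specialize (Hu0 y Hy); lra.
      + intros s _; destruct (Hb s) as [-> ->]; lra.
    - cut (1 * u x t + - K <= 0); [lra|].
      apply (barrier_comparison u ut ux uxx (fun x t => - m ^ 2 * u x t + F x (u x t))
        (fun _ => - K) (fun _ => 0) (fun _ => 0) 1 0 1 1 0); auto using Rlt_0_1, is_derive_cst.
      + intros y s Hy _ Hgt; set (v := u y s) in *.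
        assert (Ev : clamp 0 K v = K)
          by (unfold clamp, Rmax, Rmin; repeat destruct Rle_dec; lra).
        unfold F; rewrite Ev, clamp_id by lra.
        assert (Hay := proj1 (Rabs_le_between _ _) (Ha y ltac:(lra))).
        assert (H1 : a y * K ^ 2 <= Ma * K * K) by (pose proof (pow2_ge_0 K); nra).
        assert (H2 : Ma * K * K <= m ^ 2 * K) by (apply Rmult_le_compat_r; lra).
        assert (H3 : m ^ 2 * K <= m ^ 2 * v) by (apply Rmult_le_compat_l; [apply pow2_ge_0|lra]).
        lra.
      + intros y Hy; rewrite Hi' by assumption; specialize (Hu0 y Hy); lra.
      + intros s _; destruct (Hb s) as [-> ->]; lra. }
  exists u; split; [exact Hc|]; split; [|split; [intros; apply Hb|assumption]].
  intros x t Hx Ht; destruct (Hd x t Hx Ht) as [D1 [D2 [D3 D4]]].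
  assert (Hux : forall y, 0 < y < 1 -> Derive (fun y' => u y' t) y = ux y t)
    by (intros y Hy; apply is_derive_unique, Hd; assumption).
  assert (D3' : is_derive (fun y => Derive (fun y' => u y' t) y) x (uxx x t)).
  { apply is_derive_ext_loc with (fun y => ux y t); [|assumption].
    exists (mkposreal (Rmin x (1 - x)) (Rmin_glb_lt x (1 - x) 0 ltac:(lra) ltac:(lra))).
    intros y Hy; symmetry; apply Hux.
    assert (Hy1 := Rlt_le_trans _ _ _ Hy (Rmin_l _ _)); assert (Hy2 := Rlt_le_trans _ _ _ Hy (Rmin_r _ _)).
    revert Hy1 Hy2; unfold abs, minus, plus, opp; simpl; unfold Rabs; destruct Rcase_abs; lra. }
  split; [eexists; exact D1|]; split; [intros y Hy; eexists; now apply Hd|].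
  split; [eexists; exact D3'|].
  assert (Et : Derive (fun s => u x s) t = ut x t) by exact (is_derive_unique _ _ _ D1).
  assert (Exx : Derive_n (fun y => u y t) 2 x = uxx x t) by exact (is_derive_unique _ _ _ D3').
  rewrite Et, Exx, D4; unfold F.
  rewrite !clamp_id; [reflexivity|apply Hrange; lra|lra].
Qed.

(** * Choice of the thresholds for [lambda] *)

Lemma partition_range (z : nat -> R) (n : nat) :
  z 0%nat = 0 -> z n = 1 -> (forall k, (k < n)%nat -> z k < z (S k)) ->
  forall i, (i <= n)%nat -> 0 <= z i <= 1.
Proof.
  intros Hz0 Hzn Hz.
  assert (Hmono : forall j i, (i + j <= n)%nat -> z i <= z (i + j)%nat).
  { induction j as [|j IH]; intros i Hij; [rewrite Nat.add_0_r; lra|].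
    rewrite Nat.add_succ_r; specialize (IH i ltac:(lia)); specialize (Hz (i + j)%nat ltac:(lia)); lra. }
  intros i Hi; rewrite <- Hz0 at 1; rewrite <- Hzn; split.
  - apply (Hmono i 0%nat); lia.
  - replace n with (i + (n - i))%nat by lia; apply Hmono; lia.
Qed.

Theorem theorem1p1 (a : R -> R) (n : nat) (z : nat -> R) (e : R)
  (u0 : R -> R) (lambda0 : R) (k : nat) :
  interlacing_weight a n z e ->
  (* I^+ := (z k, z (k+1)) is a positive interval of a *)
  (k < n)%nat -> e * (-1) ^ k = 1 ->
  (* u0 >= 0, u0 not identically 0, weak subsolution of (E_lambda0) *)
  (forall x, 0 <= x <= 1 -> 0 <= u0 x) ->
  (exists x, 0 <= x <= 1 /\ u0 x <> 0) ->
  weak_subsolution a lambda0 u0 ->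
  (* u0 = 0 on I^+ and its adjacent negative intervals (on [0,..]/[..,1] at the ends) *)
  let L := match k with O => 0 | S k' => z k' end in
  let Rt := if Nat.eqb (S k) n then 1 else z (S (S k)) in
  (forall x, L < x < Rt -> u0 x = 0) ->
  exists T, 0 < T /\
    (exists Lam, forall lambda, lambda <= Lam ->
       exists u, parabolic_solution a lambda u0 T u) /\
    (forall c d, L < c -> d < Rt -> forall eps, 0 < eps ->
       exists Lam, forall lambda, lambda <= Lam ->
         forall u, parabolic_solution a lambda u0 T u ->
           forall t x, 0 <= t <= T -> c <= x <= d -> Rabs (u x t) < eps).
Proof.
  intros [Hac [_ [Hz0 [Hzn [Hz _]]]]] Hk _ Hpos _ [Huc [Hu00 [Hu01 _]]] L Rt Hzero.
  assert (Hzr := partition_range z n Hz0 Hzn Hz).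
  assert (HL : 0 <= L) by (unfold L; destruct k; [lra|apply Hzr; lia]).
  assert (HR : Rt <= 1).
  { unfold Rt; destruct (Nat.eqb_spec (S k) n); [lra|apply Hzr; lia]. }
  assert (E0 : u0 0 = 0) by (specialize (Hpos 0 ltac:(lra)); lra).
  assert (E1 : u0 1 = 0) by (specialize (Hpos 1 ltac:(lra)); lra).
  destruct (cont_on01_bounded a Hac) as [Ma [HMa Ha]].
  destruct (cont_on01_bounded u0 Huc) as [K [HK HuK]].
  assert (Hu0 : forall x, 0 <= x <= 1 -> 0 <= u0 x <= K).
  { intros x Hx; split; [auto|]; specialize (HuK x Hx); apply Rabs_le_between in HuK; lra. }
  assert (HMK : 0 < Ma * K) by now apply Rmult_lt_0_compat.
  exists 1; split; [lra|]; split.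
  (* The summand 1 forces [m >= 1], so that [m ^ 2 >= m >= Ma * K]. *)
  - set (m0 := 16 * (Ma * K) + 1).
    exists (- m0 ^ 2); intros lambda Hlam.
    set (m := sqrt (- lambda)).
    assert (Em : m ^ 2 = - lambda) by (apply pow2_sqrt; pose proof (pow2_ge_0 m0); lra).
    assert (Hm0 : m0 <= m).
    { apply Rsqr_incr_0_var; [|apply sqrt_pos]; rewrite !Rsqr_pow2; lra. }
    replace lambda with (- m ^ 2) by lra.
    apply (parabolic_existence a u0 Ma K m); try assumption; try lra; unfold m0 in *; nra.
  - intros c d Hc Hd eps Heps.
    (* Since [exp (- q * y) <= 1 / (q * y)], the barrier on [[c, d]] is at most
       [K * (/ (c - L) + / (Rt - d)) / q], which is [eps * (q - 1) / q] for this [q], hence below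
       [eps]. *)
    set (q := K * (/ (c - L) + / (Rt - d)) / eps + 1).
    exists (- (Ma * K) - q ^ 2); intros lambda Hlam u Hsol t x Ht Hx.
    assert (Hcl : 0 < / (c - L)) by (apply Rinv_0_lt_compat; lra).
    assert (Hdr : 0 < / (Rt - d)) by (apply Rinv_0_lt_compat; lra).
    assert (Hq0 : 0 < K * (/ (c - L) + / (Rt - d)) / eps)
      by (apply Rdiv_lt_0_compat; [apply Rmult_lt_0_compat; lra|assumption]).
    assert (Hq : 0 < q) by (unfold q; lra).
    destruct (parabolic_decay a lambda u0 1 u Ma K q L Rt) with (x := x) (t := t) as [H1 H2];
      try assumption; try lra.
    rewrite Rabs_right by lra; apply Rle_lt_trans with (1 := H2).
    assert (Hexp : forall y y0, 0 < y0 -> y0 <= y -> exp (- q * y) <= / q * / y0).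
    { intros y y0 Hy0 Hy; replace (- q * y) with (- (q * y)) by ring.
      apply Rle_trans with (1 := exp_neg_le_inv _ (Rmult_lt_0_compat _ _ Hq (Rlt_le_trans _ _ _ Hy0 Hy))).
      rewrite <- Rinv_mult; apply Rinv_le_contravar; [now apply Rmult_lt_0_compat|].
      apply Rmult_le_compat_l; lra. }
    assert (Hx1 := Hexp (x - L) (c - L) ltac:(lra) ltac:(lra)).
    assert (Hx2 := Hexp (Rt - x) (Rt - d) ltac:(lra) ltac:(lra)).
    apply Rle_lt_trans with (K * (/ (c - L) + / (Rt - d)) * / q).
    + rewrite Rmult_assoc; apply Rmult_le_compat_l; lra.
    + apply Rmult_lt_reg_r with q; [assumption|].
      rewrite Rmult_assoc, Rinv_l, Rmult_1_r by lra.
      replace (K * (/ (c - L) + / (Rt - d))) with (eps * (q - 1)) by (unfold q; field; lra).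
      nra.
Qed.
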